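(* Let $k$ be an algebraically closed field, let $A$ be a finite-dimensional $k$-algebra, and let $\Gamma$ be a connected component of the Auslander-Reiten quiver of $A$. If $\Gamma$ is both generalized standard and mesh-comparable, then $\Gamma$ is standard.
   Context: Algebras are associative and unital; $\operatorname{mod} A$ is the category of finitely generated right $A$-modules. The radical $\operatorname{rad}_A$ is the ideal of $\operatorname{mod} A$ such that for $X,Y$ indecomposable $\operatorname{rad}_A(X,Y)$ is the set of non-isomorphisms $X\to Y$, extended to direct sums componentwise; $\operatorname{rad}^0=\operatorname{Hom}_A$, $\operatorname{rad}^n=\operatorname{rad}^{n-1}\cdot\operatorname{rad}$, $\operatorname{rad}^\infty=\bigcap_{n\ge 0}\operatorname{rad}^n$. The Auslander-Reiten quiver of $A$ has as vertices the isomorphism classes of indecomposable $A$-modules, and $\dim_k \operatorname{rad}(M,N)/\operatorname{rad}^2(M,N)$ arrows from $M$ to $N$. A connected component $\Gamma$ is a translation quiver with the Auslander-Reiten translation $\tau$: for every non-projective vertex $x$ and every vertex $y$ a bijection $\alpha\mapsto\sigma(\alpha)$ from arrows $y\to x$ to arrows $\tau x\to y$ is fixed. Vertices of $\Gamma$ are identified with (fixed representatives of) indecomposable modules; $\operatorname{ind}\Gamma$ is the full subcategory of $\operatorname{mod} A$ given by the indecomposable modules in $\Gamma$. The path category $k\Gamma$ has the vertices of $\Gamma$ as objects, and as morphisms $x\to y$ the formal $k$-linear combinations of paths from $x$ to $y$. The mesh category $k(\Gamma)$ is the quotient of $k\Gamma$ by the ideal generated by the mesh relations $\sum \alpha\,\sigma(\alpha):\tau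 x\to x$, where $x$ is non-projective and the sum runs over all arrows $\alpha$ ending at $x$; $\overline{\alpha}$ is the class of an arrow $\alpha$. A Riedtmann functor is a $k$-linear functor $F:k(\Gamma)\to\operatorname{ind}\Gamma$ such that for every vertex $X$: (1) $FX=X$; (2) if $\alpha_i:X\to X_i$, $1\le i\le r$, are all the arrows starting at $X$, then $[F(\overline{\alpha_1})\ \cdots\ F(\overline{\alpha_r})]^t:X\to X_1\oplus\cdots\oplus X_r$ is left minimal almost split; (3) if $\alpha_i:X_i\to X$, $1\le i\le r$, are all the arrows ending at $X$, then $[F(\overline{\alpha_1})\ \cdots\ F(\overline{\alpha_r})]:X_1\oplus\cdots\oplus X_r\to X$ is right minimal almost split. $\Gamma$ is mesh-comparable if a Riedtmann functor $k(\Gamma)\to\operatorname{ind}\Gamma$ exists. $\Gamma$ is standard if there is an isomorphism of categories $k(\Gamma)\cong\operatorname{ind}\Gamma$. $\Gamma$ is generalized standard if $\operatorname{rad}^\infty(X,Y)=0$ for all $X,Y\in\Gamma$. *)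

(* Defs.v *)
From HB Require Import structures.
From Stdlib Require Import Relation_Operators.
From mathcomp Require Import all_boot all_algebra falgebra.
From mathcomp Require Import generic_quotient ring_quotient.
From mathcomp Require Import finmap boolp.
From mathcomp Require Import monalg.

Set Implicit Arguments.
Unset Strict Implicit.
Unset Printing Implicit Defensive.

Import GRing.Theory.
Local Open Scope ring_scope.
Local Open Scope quotient_scope.

Reserved Notation "g \oc f" (at level 40, left associativity).

(* [comp g f] is "g after f": products of arrows, of morphisms and of ideals
   are all written from right to left. *)
Record kcat (k : fieldType) := KCat {
  obj :> Type;
  hom : obj -> obj -> lmodType k;
  idm : forall x, hom x x;
  comp : forall x y z, hom y z -> hom x y -> hom x z;
  comp_linl : forall x y z (f : hom x y) a (g g' : hom y z),
    comp (a *: g + g') f = a *: comp g f + comp g' f;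
  comp_linr : forall x y z (g : hom y z) a (f f' : hom x y),
    comp g (a *: f + f') = a *: comp g f + comp g f';
  compA : forall x y z t (h : hom z t) (g : hom y z) (f : hom x y),
    comp h (comp g f) = comp (comp h g) f;
  comp_idl : forall x y (f : hom x y), comp (idm y) f = f;
  comp_idr : forall x y (f : hom x y), comp f (idm x) = f
}.
Arguments idm {k C} x : rename.
Arguments comp {k C x y z} g f : rename.
Notation "g \oc f" := (comp g f) : ring_scope.

Section Functors.
Variable k : fieldType.

Record kfunctor (C D : kcat k) := KFunctor {
  fobj :> C -> D;
  fmap : forall x y, hom x y -> hom (fobj x) (fobj y);
  fmap_lin : forall x y a (f g : hom x y),
    fmap (a *: f + g) = a *: fmap f + fmap g;
  fmap_id : forall x, fmap (idm x) = idm (fobj x);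
  fmap_comp : forall x y z (g : hom y z) (f : hom x y),
    fmap (g \oc f) = fmap g \oc fmap f
}.

Definition kfunctor_id (C : kcat k) : kfunctor C C.
Proof. by exists id (fun x y (f : hom x y) => f). Defined.

Definition kfunctor_comp (C D E : kcat k)
  (G : kfunctor D E) (F : kfunctor C D) : kfunctor C E.
Proof.
exists (fun x => G (F x)) (fun x y (f : hom x y) => fmap G (fmap F f)).
- by move=> x y a f g; rewrite !fmap_lin.
- by move=> x; rewrite !fmap_id.
- by move=> x y z g f; rewrite !fmap_comp.
Defined.

Definition isomorphic_kcat (C D : kcat k) : Prop :=
  exists (F : kfunctor C D) (G : kfunctor D C),
    kfunctor_comp G F = kfunctor_id C /\ kfunctor_comp F G = kfunctor_id D.

Definition full_sub (C : kcat k) (V : Type) (M : V -> C) : kcat k.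
Proof.
exists V (fun x y => hom (M x) (M y)) (fun x => idm (M x))
  (fun x y z (g : hom (M y) (M z)) (f : hom (M x) (M y)) => g \oc f).
- by move=> *; apply: comp_linl.
- by move=> *; apply: comp_linr.
- by move=> *; apply: compA.
- by move=> *; apply: comp_idl.
- by move=> *; apply: comp_idr.
Defined.

End Functors.

Section KCatTheory.
Variables (k : fieldType) (C : kcat k).

Lemma comp0l (x y z : C) (f : hom x y) : (0 : hom y z) \oc f = 0.
Proof. by have := comp_linl f (-1) (0 : hom y z) 0; rewrite scaler0 addr0 scaleN1r addNr. Qed.

Lemma comp0r (x y z : C) (g : hom y z) : g \oc (0 : hom x y) = 0.
Proof. by have := comp_linr g (-1) (0 : hom x y) 0; rewrite scaler0 addr0 scaleN1r addNr. Qed.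

Lemma compBl (x y z : C) (f : hom x y) (g g' : hom y z) :
  (g - g') \oc f = g \oc f - g' \oc f.
Proof. by rewrite addrC -scaleN1r comp_linl scaleN1r addrC. Qed.

Lemma compBr (x y z : C) (g : hom y z) (f f' : hom x y) :
  g \oc (f - f') = g \oc f - g \oc f'.
Proof. by rewrite addrC -scaleN1r comp_linr scaleN1r addrC. Qed.

End KCatTheory.

Section CategoricalNotions.
Variables (k : fieldType) (C : kcat k).
Implicit Types X Y Z : C.

Definition is_iso X Y (f : hom X Y) : Prop :=
  exists g : hom Y X, g \oc f = idm X /\ f \oc g = idm Y.

Definition isomorphic X Y : Prop := exists f : hom X Y, is_iso f.

Definition split_mono X Y (f : hom X Y) : Prop :=
  exists g : hom Y X, g \oc f = idm X.

Definition split_epi X Y (f : hom X Y) : Prop :=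
  exists g : hom Y X, f \oc g = idm Y.

Definition is_zero X : Prop := idm X = 0.

(* S is the direct sum of the Xs i, characterized as a biproduct. *)
Definition is_direct_sum (I : finType) (Xs : I -> C) (S : C)
    (inj : forall i, hom (Xs i) S) (proj : forall i, hom S (Xs i)) : Prop :=
  [/\ forall i, proj i \oc inj i = idm (Xs i),
      forall i j, i != j -> proj j \oc inj i = 0
    & \sum_i inj i \oc proj i = idm S].

Definition indecomposable X : Prop :=
  ~ is_zero X /\
  forall (Xs : bool -> C) inj proj, @is_direct_sum _ Xs X inj proj ->
    is_zero (Xs true) \/ is_zero (Xs false).

Definition left_minimal_almost_split X Y (f : hom X Y) : Prop :=
  [/\ ~ split_mono f,
      forall Z (h : hom X Z), ~ split_mono h -> exists h' : hom Y Z, h = h' \oc f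
    & forall e : hom Y Y, e \oc f = f -> is_iso e].

Definition right_minimal_almost_split X Y (f : hom X Y) : Prop :=
  [/\ ~ split_epi f,
      forall Z (h : hom Z Y), ~ split_epi h -> exists h' : hom Z X, h = f \oc h'
    & forall e : hom X X, f \oc e = f -> is_iso e].

(* For X and Y indecomposable these are the non-isomorphisms; in general, every
   component with respect to decompositions into indecomposables has to be a
   non-isomorphism. *)
Definition rad X Y (f : hom X Y) : Prop :=
  exists (m n : nat) (Xs : 'I_m -> C) (Ys : 'I_n -> C)
    (iX : forall i, hom (Xs i) X) (pX : forall i, hom X (Xs i))
    (iY : forall j, hom (Ys j) Y) (pY : forall j, hom Y (Ys j)),
    [/\ is_direct_sum iX pX, is_direct_sum iY pY,
        forall i, indecomposable (Xs i), forall j, indecomposable (Ys j)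
      & forall i j, ~ is_iso (pY j \oc f \oc iX i)].

Definition hom_family := forall X Y, hom X Y -> Prop.

(* Finite sums of composites g \oc f with g in I and f in J. *)
Definition prod_family (I J : hom_family) : hom_family := fun X Z u =>
  exists (n : nat) (Y : 'I_n -> C)
    (g : forall i, hom (Y i) Z) (f : forall i, hom X (Y i)),
    [/\ forall i, I _ _ (g i), forall i, J _ _ (f i)
      & u = \sum_i g i \oc f i].

Fixpoint rad_pow (n : nat) : hom_family :=
  if n is n'.+1 then prod_family (rad_pow n') rad else fun _ _ _ => True.

Definition rad_infty : hom_family := fun X Y f => forall n, rad_pow n f.

(* dim_k U / W = n, for subspaces W <= U of L: there is a basis of U modulo W
   with n elements. *)
Definition quotient_dim (L : lmodType k) (U W : L -> Prop) (n : nat) : Prop :=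
  exists b : 'I_n -> L,
    [/\ forall i, U (b i),
        forall u, U u -> exists c : 'I_n -> k, W (u - \sum_i c i *: b i)
      & forall c : 'I_n -> k, W (\sum_i c i *: b i) -> forall i, c i = 0].

Definition num_arrows X Y (n : nat) : Prop :=
  quotient_dim (@rad X Y) (@rad_pow 2 X Y) n.

End CategoricalNotions.

Section Ideals.
Variables (k : fieldType) (C : kcat k).

Record ideal := Ideal {
  imem : hom_family C;
  ideal0 : forall x y, imem (0 : hom x y);
  ideal_lin : forall x y a (u v : hom x y), imem u -> imem v -> imem (a *: u + v);
  ideal_compl : forall x y z (g : hom y z) (f : hom x y), imem f -> imem (g \oc f);
  ideal_compr : forall x y z (g : hom y z) (f : hom x y), imem g -> imem (g \oc f)
}.

Inductive ideal_span (R : hom_family C) : hom_family C :=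
| Span_rel x y (u : hom x y) : R x y u -> ideal_span R u
| Span0 x y : ideal_span R (0 : hom x y)
| Span_lin x y a (u v : hom x y) :
    ideal_span R u -> ideal_span R v -> ideal_span R (a *: u + v)
| Span_compl x y z (g : hom y z) (f : hom x y) :
    ideal_span R f -> ideal_span R (g \oc f)
| Span_compr x y z (g : hom y z) (f : hom x y) :
    ideal_span R g -> ideal_span R (g \oc f).

Definition generated_ideal (R : hom_family C) : ideal :=
  Ideal (@Span0 R) (@Span_lin R) (@Span_compl R) (@Span_compr R).

End Ideals.

Section QuotientCategory.
Variables (k : fieldType) (C : kcat k) (J : ideal C).

Section Hom.
Variables x y : C.

Definition ideal_pred : {pred hom x y} := fun u => `[< imem J u >].

Lemma ideal_predP (u : hom x y) : reflect (imem J u) (u \in ideal_pred).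
Proof. exact: asboolP. Qed.

Fact ideal_zmod_closed : zmod_closed ideal_pred.
Proof.
split; first by apply/ideal_predP; apply: ideal0.
move=> u v /ideal_predP Ju /ideal_predP Jv; apply/ideal_predP.
by rewrite addrC -scaleN1r; apply: ideal_lin.
Qed.
HB.instance Definition _ := GRing.isZmodClosed.Build _ ideal_pred ideal_zmod_closed.

Definition qhom := Quotient.quot ideal_pred.
HB.instance Definition _ := GRing.Zmodule.on qhom.
HB.instance Definition _ := EqQuotient.on qhom.

Definition qpi (u : hom x y) : qhom := \pi_qhom u.

Lemma qpiP u v : (qpi u = qpi v) <-> imem J (u - v).
Proof.
split=> [e|/ideal_predP]; last first.
  by rewrite Quotient.idealrBE => /eqP.
by apply/ideal_predP; rewrite Quotient.idealrBE; apply/eqP.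
Qed.

Lemma qpiD u v : qpi (u + v) = qpi u + qpi v.
Proof. exact: (Quotient.pi_add ideal_pred). Qed.

Lemma qreprK (u : qhom) : qpi (repr u) = u.
Proof. exact: reprK. Qed.

Lemma qrepr_sub u : imem J (repr (qpi u) - u).
Proof. by apply/qpiP; rewrite qreprK. Qed.

Definition qscale (a : k) (u : qhom) : qhom := qpi (a *: repr u).

Lemma qpiZ a u : qpi (a *: u) = qscale a (qpi u).
Proof.
apply/esym/qpiP; rewrite -scalerBr -[_ *: _]addr0.
by apply: ideal_lin (ideal0 _ _ _); apply: qrepr_sub.
Qed.

Fact qscaleA a b u : qscale a (qscale b u) = qscale (a * b) u.
Proof. by rewrite -(qreprK u) -!qpiZ scalerA. Qed.
Fact qscale1 : left_id 1 qscale.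
Proof. by move=> u; rewrite -(qreprK u) -!qpiZ scale1r. Qed.
Fact qscaleDr : right_distributive qscale +%R.
Proof. by move=> a u v; rewrite -(qreprK u) -(qreprK v) -qpiD -!qpiZ -qpiD scalerDr. Qed.
Fact qscaleDl u : {morph qscale^~ u : a b / a + b}.
Proof. by move=> a b; rewrite -(qreprK u) -!qpiZ -qpiD scalerDl. Qed.
HB.instance Definition _ := GRing.Zmodule_isLmodule.Build k qhom
  qscaleA qscale1 qscaleDr qscaleDl.

Lemma qpi_lin a u v : qpi (a *: u + v) = a *: qpi u + qpi v.
Proof. by rewrite qpiD qpiZ. Qed.

End Hom.

Definition qcomp x y z (g : qhom y z) (f : qhom x y) : qhom x z :=
  qpi (repr g \oc repr f).

Lemma qcompE x y z (g : hom y z) (f : hom x y) :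
  qcomp (qpi g) (qpi f) = qpi (g \oc f).
Proof.
apply/qpiP; set g' := repr _; set f' := repr _.
have -> : g' \oc f' - g \oc f = 1 *: ((g' - g) \oc f') + g \oc (f' - f).
  by rewrite compBl compBr scale1r addrA addrNK.
by apply: ideal_lin; [apply: ideal_compr|apply: ideal_compl]; apply: qrepr_sub.
Qed.

Definition quotient_kcat : kcat k.
Proof.
exists C (fun x y => (qhom x y : lmodType k)) (fun x => qpi (idm x)) qcomp.
- move=> x y z f a g g'.
  by rewrite -(qreprK f) -(qreprK g) -(qreprK g') -qpi_lin !qcompE comp_linl qpi_lin.
- move=> x y z g a f f'.
  by rewrite -(qreprK g) -(qreprK f) -(qreprK f') -qpi_lin !qcompE comp_linr qpi_lin.
- move=> x y z t h g f.
  by rewrite -(qreprK h) -(qreprK g) -(qreprK f) !qcompE compA.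
- by move=> x y f; rewrite -(qreprK f) qcompE comp_idl.
- by move=> x y f; rewrite -(qreprK f) qcompE comp_idr.
Defined.

End QuotientCategory.

Section PathCategory.
Variables (k : fieldType) (V : Type) (arr : V -> V -> finType).

Inductive qpath : V -> V -> Type :=
| PNil x : qpath x x
| PCons x y z : arr y z -> qpath x y -> qpath x z.

Fixpoint pcat x y z (q : qpath y z) : qpath x y -> qpath x z :=
  match q in qpath y z return qpath x y -> qpath x z with
  | PNil _ => fun p => p
  | PCons _ _ _ a q' => fun p => PCons a (pcat q' p)
  end.

Lemma pcatA x y z t (r : qpath z t) (q : qpath y z) (p : qpath x y) :
  pcat r (pcat q p) = pcat (pcat r q) p.
Proof. by elim: r q => //= ? ? ? a r IH q; rewrite IH. Qed.

Lemma pcat_nil x y (q : qpath x y) : pcat q (PNil x) = q.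
Proof. by elim: q => //= ? ? ? a q ->. Qed.

HB.instance Definition _ x y := gen_eqMixin (qpath x y).
HB.instance Definition _ x y := gen_choiceMixin (qpath x y).

Definition khom x y := {malg k[qpath x y]}.
HB.instance Definition _ x y := GRing.Lmodule.on (khom x y).

Definition kpath x y (p : qpath x y) : khom x y := << p >>.

Definition kcomp x y z (g : khom y z) (f : khom x y) : khom x z :=
  \sum_(q <- msupp g) \sum_(p <- msupp f) (g@_q * f@_p) *: kpath (pcat q p).

Lemma kcompE x y z (g : khom y z) (f : khom x y) (D : {fset qpath y z})
    (E : {fset qpath x y}) : (msupp g `<=` D)%fset -> (msupp f `<=` E)%fset ->
  kcomp g f = \sum_(q <- D) \sum_(p <- E) (g@_q * f@_p) *: kpath (pcat q p).
Proof.
move=> sD sE; rewrite /kcomp (big_fset_incl _ sD); last first.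
  move=> q _ /mcoeff_outdom ->; rewrite big1 // => p _.
  by rewrite mul0r scale0r.
apply: eq_bigr => q _; apply: (big_fset_incl _ sE) => p _ /mcoeff_outdom ->.
by rewrite mulr0 scale0r.
Qed.

Lemma kcomp_linl x y z (f : khom x y) a (g g' : khom y z) :
  kcomp (a *: g + g') f = a *: kcomp g f + kcomp g' f.
Proof.
pose D := (msupp g `|` msupp g' `|` msupp (a *: g + g'))%fset.
have s1 : (msupp g `<=` D)%fset by rewrite /D -fsetUA fsubsetUl.
have s2 : (msupp g' `<=` D)%fset by rewrite /D fsetUAC fsubsetUr.
have s3 : (msupp (a *: g + g') `<=` D)%fset by rewrite /D fsubsetUr.
rewrite (kcompE s1 (fsubset_refl _)) (kcompE s2 (fsubset_refl _)).
rewrite (kcompE s3 (fsubset_refl _)).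
rewrite scaler_sumr -big_split; apply: eq_bigr => q _ /=.
rewrite scaler_sumr -big_split; apply: eq_bigr => p _ /=.
by rewrite mcoeffD mcoeffZ mulrDl scalerDl scalerA mulrA.
Qed.

Lemma kcomp_linr x y z (g : khom y z) a (f f' : khom x y) :
  kcomp g (a *: f + f') = a *: kcomp g f + kcomp g f'.
Proof.
pose D := (msupp f `|` msupp f' `|` msupp (a *: f + f'))%fset.
have s1 : (msupp f `<=` D)%fset by rewrite /D -fsetUA fsubsetUl.
have s2 : (msupp f' `<=` D)%fset by rewrite /D fsetUAC fsubsetUr.
have s3 : (msupp (a *: f + f') `<=` D)%fset by rewrite /D fsubsetUr.
rewrite (kcompE (fsubset_refl _) s1) (kcompE (fsubset_refl _) s2).
rewrite (kcompE (fsubset_refl _) s3).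
rewrite scaler_sumr -big_split; apply: eq_bigr => q _ /=.
rewrite scaler_sumr -big_split; apply: eq_bigr => p _ /=.
by rewrite mcoeffD mcoeffZ mulrDr scalerDl scalerA mulrCA.
Qed.

Lemma kcomp_path x y z (q : qpath y z) (p : qpath x y) :
  kcomp (kpath q) (kpath p) = kpath (pcat q p).
Proof.
by rewrite (kcompE msuppU_le msuppU_le) !big_seq_fset1 !mcoeffUU mulr1 scale1r.
Qed.

Lemma khom_ind x y (P : khom x y -> Prop) :
  P 0 -> (forall a p u, P u -> P (a *: kpath p + u)) -> forall u, P u.
Proof.
move=> P0 PS u; rewrite [u]monalgE; elim: (X in \sum_(i <- X) _) => [|p s IH].
  by rewrite big_nil.
rewrite big_cons; have -> : << u@_p *g p >> = u@_p *: kpath p; last exact: PS.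
by apply/malgP=> q; rewrite mcoeffZ !mcoeffU mulrnAr mulr1.
Qed.

Lemma kcomp0l x y z (f : khom x y) : kcomp (0 : khom y z) f = 0.
Proof.
have := kcomp_linl f (-1) (0 : khom y z) 0.
by rewrite scaler0 addr0 scaleN1r addNr.
Qed.

Lemma kcomp0r x y z (g : khom y z) : kcomp g (0 : khom x y) = 0.
Proof.
have := kcomp_linr g (-1) (0 : khom x y) 0.
by rewrite scaler0 addr0 scaleN1r addNr.
Qed.

Lemma kcompA x y z t (h : khom z t) (g : khom y z) (f : khom x y) :
  kcomp h (kcomp g f) = kcomp (kcomp h g) f.
Proof.
have A1 (r : qpath z t) (q : qpath y z) :
    kcomp (kpath r) (kcomp (kpath q) f) = kcomp (kcomp (kpath r) (kpath q)) f.
  elim/khom_ind: f => [|c p f IHf].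
    by rewrite (kcomp0r _ (kpath q)) (kcomp0r _ (kpath r)) kcomp0r.
  rewrite (kcomp_linr (kpath q) c) (kcomp_linr (kpath r) c).
  by rewrite (kcomp_linr (kcomp _ _) c) IHf !kcomp_path pcatA.
have A2 (r : qpath z t) : kcomp (kpath r) (kcomp g f) = kcomp (kcomp (kpath r) g) f.
  elim/khom_ind: g => [|b q g IHg].
    by rewrite (kcomp0l _ f) (kcomp0r _ (kpath r)) kcomp0r kcomp0l.
  rewrite (kcomp_linl f b) (kcomp_linr (kpath r) b) (kcomp_linr (kpath r) b).
  by rewrite (kcomp_linl f b) IHg A1.
elim/khom_ind: h => [|a r h IHh]; first by rewrite (kcomp0l _ g) !kcomp0l.
by rewrite (kcomp_linl g) (kcomp_linl f) (kcomp_linl _ a) IHh A2.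
Qed.

Definition path_kcat : kcat k.
Proof.
exists V (fun x y => (khom x y : lmodType k)) (fun x => kpath (PNil x)) kcomp.
- exact: kcomp_linl.
- exact: kcomp_linr.
- exact: kcompA.
- move=> x y f; elim/khom_ind: f => [|c p f IHf]; first by rewrite kcomp0r.
  by rewrite kcomp_linr IHf kcomp_path.
- move=> x y f; elim/khom_ind: f => [|c p f IHf]; first by rewrite kcomp0l.
  by rewrite kcomp_linl IHf kcomp_path pcat_nil.
Defined.

Definition karrow x y (a : arr x y) : hom (x : path_kcat) y :=
  kpath (PCons a (PNil x)).

End PathCategory.

Section Modules.
Variables (k : fieldType) (A : falgType k).

(* A right A-module is a left module over the opposite algebra A^c: for m in M
   and a in A, the element m.a is written (a : A^c) *: m. *)
Record rmod := RMod {
  rmod_sort :> lmodType A^c;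
  rmod_fg : exists (n : nat) (g : 'I_n -> rmod_sort),
    forall m, exists a : 'I_n -> A^c, m = \sum_i a i *: g i
}.

Section Hom.
Variables X Y : rmod.

Definition rhom : Type := {linear X -> Y}.

Definition rhom_fun (f : rhom) : X -> Y := (f : {linear X -> Y}).
Coercion rhom_fun : rhom >-> Funclass.
HB.instance Definition _ (f : rhom) := GRing.Linear.on (rhom_fun f).

Lemma rhomP (f g : rhom) : (forall x, f x = g x) -> f = g.
Proof.
case: f g => [f [[af] [sf]]] [g [[ag] [sg]]] fg.
have {}fg : f = g by apply/funext.
rewrite -{}fg in ag sg *.
by rewrite (Prop_irrelevance af ag) (Prop_irrelevance sf sg).
Qed.

HB.instance Definition _ := gen_eqMixin rhom.
HB.instance Definition _ := gen_choiceMixin rhom.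

Definition rhom0 : rhom := (\0 : {linear X -> Y}).
Definition rhom_add (f g : rhom) : rhom := (f \+ g : {linear X -> Y}).
Definition rhom_opp (f : rhom) : rhom := (\- f : {linear X -> Y}).

Definition rhom_scale_fun (c : k) (f : rhom) (x : X) : Y := (c%:A : A^c) *: f x.

Fact rhom_scale_linear c f : linear (rhom_scale_fun c f).
Proof.
move=> a x y; rewrite /rhom_scale_fun linearP scalerDr !scalerA; congr (_ *: _ + _).
by change ((a : A) * (c%:A : A) = (c%:A : A) * (a : A)); rewrite mulr_algl mulr_algr.
Qed.
HB.instance Definition _ c f :=
  GRing.isLinear.Build A^c X Y *:%R (rhom_scale_fun c f) (rhom_scale_linear c f).
Definition rhom_scale c f : rhom := (rhom_scale_fun c f : {linear X -> Y}).

Fact rhom_addA : associative rhom_add.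
Proof. by move=> f g h; apply: rhomP => x; apply: addrA. Qed.
Fact rhom_addC : commutative rhom_add.
Proof. by move=> f g; apply: rhomP => x; apply: addrC. Qed.
Fact rhom_add0 : left_id rhom0 rhom_add.
Proof. by move=> f; apply: rhomP => x; apply: add0r. Qed.
Fact rhom_addN : left_inverse rhom0 rhom_opp rhom_add.
Proof. by move=> f; apply: rhomP => x; apply: addNr. Qed.
HB.instance Definition _ := GRing.isZmodule.Build rhom
  rhom_addA rhom_addC rhom_add0 rhom_addN.

Fact rhom_scaleA a b f : rhom_scale a (rhom_scale b f) = rhom_scale (a * b) f.
Proof.
apply: rhomP => x.
change ((a%:A : A^c) *: ((b%:A : A^c) *: f x) = ((a * b)%:A : A^c) *: f x).
rewrite scalerA; congr (_ *: _); change ((b%:A : A) * (a%:A : A) = ((a * b)%:A : A)).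
by rewrite mulr_algl scalerA mulrC.
Qed.
Fact rhom_scale1 : left_id 1 rhom_scale.
Proof.
move=> f; apply: rhomP => x; change ((1%:A : A^c) *: f x = f x).
by rewrite scale1r; apply: scale1r.
Qed.
Fact rhom_scaleDr : right_distributive rhom_scale +%R.
Proof. by move=> a f g; apply: rhomP => x; apply: scalerDr. Qed.
Fact rhom_scaleDl f : {morph rhom_scale^~ f : a b / a + b}.
Proof.
move=> a b; apply: rhomP => x.
change (((a + b)%:A : A^c) *: f x = (a%:A : A^c) *: f x + (b%:A : A^c) *: f x).
by rewrite scalerDl; apply: scalerDl.
Qed.
HB.instance Definition _ := GRing.Zmodule_isLmodule.Build k rhom
  rhom_scaleA rhom_scale1 rhom_scaleDr rhom_scaleDl.

End Hom.

Definition rhom_id (X : rmod) : rhom X X := (idfun : {linear X -> X}).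
Definition rhom_comp (X Y Z : rmod) (g : rhom Y Z) (f : rhom X Y) : rhom X Z :=
  (g \o f : {linear X -> Z}).

Definition modA : kcat k.
Proof.
exists rmod (fun X Y => (rhom X Y : lmodType k)) rhom_id rhom_comp.
- by move=> X Y Z f a g g'; apply: rhomP.
- move=> X Y Z g a f f'; apply: rhomP => x.
  exact: (linearP (g : {linear Y -> Z})).
- by move=> *; apply: rhomP.
- by move=> *; apply: rhomP.
- by move=> *; apply: rhomP.
Defined.

Definition surjective (X Y : rmod) (f : rhom X Y) : Prop :=
  forall y, exists x, f x = y.

Definition projective (P : modA) : Prop :=
  forall (X Y : modA) (g : hom X Y) (f : hom P Y),
    surjective g -> exists h : hom P X, g \oc h = f.

(* p1 : P1 -> P0 and p0 : P0 -> X form a minimal projective presentation of X: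
   p0 is a projective cover of X and p1 is, onto its image, a projective cover
   of the kernel of p0. *)
Definition minimal_projective_presentation (P1 P0 X : modA)
    (p1 : hom P1 P0) (p0 : hom P0 X) : Prop :=
  [/\ projective P0 /\ projective P1,
      surjective p0,
      forall (Q : modA) (h : hom Q P0), surjective (p0 \oc h) -> surjective h,
      forall z, (p0 : rhom _ _) z = 0 <-> exists x, (p1 : rhom _ _) x = z
    & forall (Q : modA) (h : hom Q P1),
        (forall x, exists q, (p1 \oc h : rhom _ _) q = (p1 : rhom _ _) x) ->
        surjective h].

Fact regular_fg : exists (n : nat) (g : 'I_n -> (A^c)^o),
  forall m, exists a : 'I_n -> A^c, m = \sum_i a i *: g i.
Proof.
exists 1%N, (fun=> 1) => m; exists (fun=> m).
by rewrite big_ord1; apply/esym/(@mulr1 A^c).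
Qed.
Definition regular : rmod := RMod regular_fg.

Section LeftAction.
Variables (P : rmod) (a : A) (h : rhom P regular).

Definition lact_fun (x : P) : regular := (a * (h x : A) : A).

Fact lact_linear : linear lact_fun.
Proof.
move=> b x y; rewrite /lact_fun linearP.
change ((a : A) * ((h x : A) * (b : A) + (h y : A)) =
  ((a : A) * (h x : A)) * (b : A) + (a : A) * (h y : A)).
by rewrite mulrDr mulrA.
Qed.
HB.instance Definition _ := GRing.isLinear.Build A^c P regular *:%R lact_fun lact_linear.

Definition lact : rhom P regular := (lact_fun : {linear P -> regular}).
End LeftAction.

(* N is isomorphic to D Tr X. Here Tr X is the cokernel of
   Hom_A(p1, A) : Hom_A(P0, A) -> Hom_A(P1, A), a left A-module, and
   D = Hom_k(-, k): thus D Tr X consists of the k-linear forms on Hom_A(P1, A)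
   vanishing on all the g \oc p1, and (phi.a)(h) = phi(a h). *)
Definition is_DTr (X N : modA) : Prop :=
  exists (P1 P0 : modA) (p1 : hom P1 P0) (p0 : hom P0 X),
    minimal_projective_presentation p1 p0 /\
    exists theta : (N : rmod) -> {linear hom P1 (regular : modA) -> k^o},
      [/\ forall m n h, theta (m + n) h = theta m h + theta n h,
          forall m (a : A) h, theta ((a : A^c) *: m) h = theta m (lact a h),
          injective theta
        & forall phi : {linear hom P1 (regular : modA) -> k^o},
            (forall g : hom P0 (regular : modA), phi (g \oc p1) = 0) <->
            exists n, theta n = phi].

(* One step in the Auslander-Reiten quiver, up to isomorphism. *)
Definition ar_step (X Y : modA) : Prop :=
  [/\ indecomposable X, indecomposable Y
    & [\/ isomorphic X Y,
          exists n, num_arrows X Y n.+1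
        | exists n, num_arrows Y X n.+1]].

Definition ar_connected : modA -> modA -> Prop := clos_refl_trans modA ar_step.

Record ar_component := ARComponent {
  vertex :> Type;
  vmod : vertex -> modA;
  arrow : vertex -> vertex -> finType;
  component_inhabited : inhabited vertex;
  vmod_indecomposable : forall x, indecomposable (vmod x);
  vmod_inj : forall x y, isomorphic (vmod x) (vmod y) -> x = y;
  vmod_component : forall x Y,
    ar_connected (vmod x) Y <-> exists y, isomorphic Y (vmod y);
  card_arrow : forall x y, num_arrows (vmod x) (vmod y) #|arrow x y|;
  tau : forall x, ~ projective (vmod x) -> vertex;
  tau_DTr : forall x (Nx : ~ projective (vmod x)), is_DTr (vmod x) (vmod (tau Nx));
  sigma : forall x (Nx : ~ projective (vmod x)) y, arrow y x -> arrow (tau Nx) y;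
  sigma_bij : forall x (Nx : ~ projective (vmod x)) y, bijective (@sigma x Nx y)
}.

Section Component.
Variable G : ar_component.

Definition arrows_from (x : G) := {y : G & arrow x y}.
Definition arrows_to (x : G) := {y : G & arrow y x}.

Definition path_category : kcat k := path_kcat k (@arrow G).

Inductive mesh_relation : hom_family path_category :=
| MeshRelation (x : G) (Nx : ~ projective (vmod x))
    (r : nat) (alpha : 'I_r -> arrows_to x) : bijective alpha ->
  mesh_relation (\sum_(i < r)
    karrow k (tagged (alpha i)) \oc karrow k (sigma Nx (tagged (alpha i)))).

Definition mesh_category : kcat k := quotient_kcat (generated_ideal mesh_relation).

Definition mesh_arrow (x y : G) (a : arrow x y) :
    hom (x : mesh_category) (y : mesh_category) :=
  qpi (generated_ideal mesh_relation) (karrow k a).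

Definition ind_category : kcat k := full_sub (@vmod G).

Definition arrow_image (F : kfunctor mesh_category ind_category) (x y : G)
    (a : arrow x y) : hom (vmod (F x)) (vmod (F y)) :=
  fmap F (mesh_arrow a).

(* The last two conditions are stated with F x in place of x, which is the same
   object by the first one. *)
Record Riedtmann (F : kfunctor mesh_category ind_category) : Prop := {
  Riedtmann_obj : forall x : G, F x = x :> G;
  Riedtmann_left : forall x : G,
    exists (r : nat) (alpha : 'I_r -> arrows_from x) (S : modA)
      (inj : forall i, hom (vmod (F (tag (alpha i)))) S)
      (proj : forall i, hom S (vmod (F (tag (alpha i))))),
      [/\ bijective alpha, is_direct_sum inj proj
        & left_minimal_almost_split
            (\sum_(i < r) inj i \oc arrow_image F (tagged (alpha i)))];
  Riedtmann_right : forall x : G,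
    exists (r : nat) (alpha : 'I_r -> arrows_to x) (S : modA)
      (inj : forall i, hom (vmod (F (tag (alpha i)))) S)
      (proj : forall i, hom S (vmod (F (tag (alpha i))))),
      [/\ bijective alpha, is_direct_sum inj proj
        & right_minimal_almost_split
            (\sum_(i < r) arrow_image F (tagged (alpha i)) \oc proj i)]
}.

Definition mesh_comparable : Prop :=
  exists F : kfunctor mesh_category ind_category, Riedtmann F.

Definition standard : Prop := isomorphic_kcat mesh_category ind_category.

Definition generalized_standard : Prop :=
  forall (x y : G) (f : hom (vmod x) (vmod y)), rad_infty f -> f = 0.

End Component.
End Modules.

(* Main.v *)
From HB Require Import structures.
From mathcomp Require Import all_boot all_algebra falgebra.
From mathcomp Require Import generic_quotient ring_quotient finmap boolp monalg.
Require Import Defs.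

(** Let F be a Riedtmann functor on the mesh category.  Since F fixes the
vertices, it is enough that F is full and faithful: its inverse on morphisms is
then a functor in the opposite direction.

F is full.  Let f : X -> Y be a morphism between vertices.  If f is not an
isomorphism, then it is not a split monomorphism, so it factors through the left
minimal almost split map out of X, whose components are the F(a) for the arrows
a starting at X.  If f is an isomorphism, then X = Y, and f minus a suitable
scalar is not one, because k is algebraically closed and End(X) is finite
dimensional.  Treating the cofactors of the F(a) in the same way n times shows
that f is in the image of F modulo rad^n ([Phi_full_mod_rad]).  Hom(X, Y) is
finite dimensional and rad^infty(X, Y) = 0, so the chain of the rad^n(X, Y)
reaches 0 and f is in the image ([Phi_full]).

F is faithful.  Let u : x -> y be in the kernel of F, and let g : E -> y be the
right minimal almost split map with components F(a), for the arrows a ending at y.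
Then u has no term in k.1, which would make g a split epimorphism, so u is a sum of
terms a v_a, and g kills the morphism with components F(v_a).  If y is
projective, then g is injective and F(v_a) = 0.  Otherwise the map f with
components F(sigma a) is left minimal almost split and g f = 0 by the mesh
relation; the crucial point is that f is then a kernel of g as far as
factorization goes ([almost_split_weak_kernel]).  Thus F(v_a) = F(sigma a) w,
where w = F(t) by fullness, and subtracting sigma(a) t from each v_a does not
change u, by the mesh relation again.  In all cases u is the sum of the a v_a
with all v_a in the kernel ([Phi_kernel_step]).  Iterating, u can be represented by a
combination of paths of length at least n, for every n ([Phi_kernel_trunc]).  The
mesh relations being homogeneous, the mesh ideal is graded by the length of
paths, and therefore u = 0 ([Phi_faithful]). *)

Set Implicit Arguments.
Unset Strict Implicit.
Unset Printing Implicit Defensive.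

Import GRing.Theory.
Local Open Scope ring_scope.
Local Open Scope quotient_scope.

(** * Linear categories *)

Lemma lin_map0 (k : fieldType) (L M : lmodType k) (f : L -> M) :
  (forall a u v, f (a *: u + v) = a *: f u + f v) -> f 0 = 0.
Proof. by move/(_ (-1) 0 0); rewrite scaler0 addr0 scaleN1r addNr. Qed.

Section LinearCategories.
Variables (k : fieldType) (C : kcat k).

Lemma compDl (x y z : C) (f : hom x y) (g g' : hom y z) :
  (g + g') \oc f = g \oc f + g' \oc f.
Proof. by have := comp_linl f 1 g g'; rewrite !scale1r. Qed.

Lemma compDr (x y z : C) (g : hom y z) (f f' : hom x y) :
  g \oc (f + f') = g \oc f + g \oc f'.
Proof. by have := comp_linr g 1 f f'; rewrite !scale1r. Qed.

Lemma compZl (x y z : C) (f : hom x y) a (g : hom y z) :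
  (a *: g) \oc f = a *: (g \oc f).
Proof. by have := comp_linl f a g 0; rewrite comp0l !addr0. Qed.

Lemma compZr (x y z : C) (g : hom y z) a (f : hom x y) :
  g \oc (a *: f) = a *: (g \oc f).
Proof. by have := comp_linr g a f 0; rewrite comp0r !addr0. Qed.

Lemma comp_suml (x y z : C) (I : finType) (g : I -> hom y z) (f : hom x y) :
  (\sum_i g i) \oc f = \sum_i g i \oc f.
Proof. by apply: (big_morph (comp^~ f)) => [g1 g2|]; rewrite ?compDl ?comp0l. Qed.

Lemma comp_sumr (x y z : C) (I : finType) (g : hom y z) (f : I -> hom x y) :
  g \oc (\sum_i f i) = \sum_i g \oc f i.
Proof. by apply: (big_morph (comp g)) => [f1 f2|]; rewrite ?compDr ?comp0r. Qed.

Lemma is_iso_comp (x y z : C) (g : hom y z) (f : hom x y) :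
  is_iso g -> is_iso f -> is_iso (g \oc f).
Proof.
move=> [g' [g1 g2]] [f' [f1 f2]]; exists (f' \oc g'); split.
  by rewrite -compA (compA g') g1 comp_idl.
by rewrite -compA (compA f) f2 comp_idl.
Qed.

Lemma left_minimal_almost_split_iso (x y z : C) (f : hom x y) (t : hom y z) :
  is_iso t -> left_minimal_almost_split f -> left_minimal_almost_split (t \oc f).
Proof.
move=> [t' [t't tt']] [nf Lf Mf]; split.
- by case=> g gtf; apply: nf; exists (g \oc t); rewrite -compA.
- move=> w h /Lf[h' ->]; exists (h' \oc t').
  by rewrite -compA (compA t') t't comp_idl.
- move=> e etf.
  have [u [u1 u2]] : is_iso (t' \oc (e \oc t)).
    by apply: Mf; rewrite -!compA etf compA t't comp_idl.
  have -> : e = t \oc ((t' \oc (e \oc t)) \oc t').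
    by rewrite -!compA tt' comp_idr compA tt' comp_idl.
  apply: is_iso_comp; first by exists t'.
  apply: is_iso_comp; first by exists u.
  by exists t.
Qed.

Section DirectSums.
Variables (I : finType) (Xs : I -> C) (S : C).
Variables (inj : forall i, hom (Xs i) S) (proj : forall i, hom S (Xs i)).
Hypothesis S_sum : is_direct_sum inj proj.

Lemma proj_sum_inj (x : C) (f : forall i, hom x (Xs i)) j :
  proj j \oc (\sum_i inj i \oc f i) = f j.
Proof.
case: S_sum => p1 p0 _; rewrite comp_sumr (bigD1 j) //= compA p1 comp_idl.
by rewrite big1 ?addr0 // => i ij; rewrite compA p0 // comp0l.
Qed.

Lemma sum_proj_sum_inj (x y : C) (g : forall i, hom (Xs i) y)
    (f : forall i, hom x (Xs i)) :
  (\sum_i g i \oc proj i) \oc (\sum_i inj i \oc f i) = \sum_i g i \oc f i.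
Proof.
by rewrite comp_suml; apply: eq_bigr => i _; rewrite -compA proj_sum_inj.
Qed.

End DirectSums.

(** Stated for a family of the form Xs (p j), not for two families related by
isomorphisms, so that an equality of indices never has to be transported to
morphisms. *)
Lemma direct_sum_reindex (I J : finType) (Xs : I -> C) (p : J -> I) (S S' : C)
    (inj : forall i, hom (Xs i) S) (proj : forall i, hom S (Xs i))
    (inj' : forall j, hom (Xs (p j)) S') (proj' : forall j, hom S' (Xs (p j))) :
  bijective p -> is_direct_sum inj proj -> is_direct_sum inj' proj' ->
  is_iso (\sum_j inj' j \oc proj (p j)).
Proof.
move=> [q pK qK] D D'; exists (\sum_j inj (p j) \oc proj' j).
have pinj := can_inj pK.
have D1 : is_direct_sum (fun j => inj (p j)) (fun j => proj (p j)).
  case: D => a b c; split=> // [i j ij|]; first by apply: b; rewrite (inj_eq pinj).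
  by rewrite -c [RHS](reindex p) //; exists q => ? _.
split.
  by rewrite (sum_proj_sum_inj D'); case: D1.
by rewrite (sum_proj_sum_inj D1); case: D'.
Qed.

Lemma direct_sum1 (x : C) :
  is_direct_sum (fun _ : 'I_1 => idm x) (fun _ : 'I_1 => idm x).
Proof.
split=> [i|i j|]; rewrite ?comp_idl //; first by rewrite !ord1 eqxx.
by rewrite big_ord1.
Qed.

Lemma rad_indecomposable (x y : C) (f : hom x y) :
  indecomposable x -> indecomposable y -> ~ is_iso f -> rad f.
Proof.
move=> ix iy nf; exists 1, 1, (fun=> x), (fun=> y), (fun=> idm x), (fun=> idm x),
  (fun=> idm y), (fun=> idm y).
split=> //; [exact: direct_sum1 | exact: direct_sum1 |].
by move=> _ _; rewrite comp_idl comp_idr.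
Qed.

(** Two sums of composites are added by concatenating the families of their
intermediate objects, which is why the families below are defined through
[split]. *)
Lemma rad_pow_closed n (x y : C) :
  rad_pow n (0 : hom x y) /\
  (forall a (f g : hom x y), rad_pow n f -> rad_pow n g -> rad_pow n (a *: f + g)).
Proof.
elim: n x y => [//|n IH] x y; split.
  have e : 'I_0 -> False by case.
  exists 0, (fun=> x), (fun i => False_rect _ (e i)), (fun i => False_rect _ (e i)).
  by split; [case | case | rewrite big_ord0].
move=> a f g [m [Y [u [v [Hu Hv ->]]]]] [m' [Y' [u' [v' [Hu' Hv' ->]]]]].
pose T i := match split i with inl j => Y j | inr j => Y' j end : C.
pose U (i : 'I_(m + m')) : hom (T i) y :=
  match split i as s return
    hom (match s with inl j => Y j | inr j => Y' j end : C) y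
  with inl j => a *: u j | inr j => u' j end.
pose V (i : 'I_(m + m')) : hom x (T i) :=
  match split i as s return
    hom x (match s with inl j => Y j | inr j => Y' j end : C)
  with inl j => v j | inr j => v' j end.
exists (m + m')%N, T, U, V; split.
- move=> i; rewrite /U /T; case: (split i) => j; last exact: Hu'.
  rewrite -[_ *: _]addr0; have [H0 HS] := IH (Y j) y; exact: HS (Hu j) H0.
- by move=> i; rewrite /V /T; case: (split i) => j; [apply: Hv | apply: Hv'].
- rewrite big_split_ord scaler_sumr; congr (_ + _); apply: eq_bigr => i _.
    rewrite /U /V /T; case: splitP => j /= => [/ord_inj <-|]; first by rewrite compZl.
    by move=> e; have := ltn_ord i; rewrite e ltnNge leq_addr.
  rewrite /U /V /T; case: splitP => j /= => [e|/addnI/ord_inj <- //].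
  by have := ltn_ord j; rewrite -e ltnNge leq_addr.
Qed.

Lemma rad_pow_anti n m (x y : C) (f : hom x y) :
  (n <= m)%N -> rad_pow m f -> rad_pow n f.
Proof.
elim: n m x y f => [//|n IH] m x y f; case: m => [//|m] nm.
case=> r [Y [u [v [Hu Hv ->]]]].
exists r, Y, u, v; split=> // i; exact: (IH m _ _ _ nm (Hu i)).
Qed.

End LinearCategories.

(** * Finite dimension without bases *)

Section FiniteDimension.
Variables (k : fieldType) (L : lmodType k).

Definition dependent d (v : 'I_d -> L) : Prop :=
  exists c : 'I_d -> k, (exists i, c i != 0) /\ \sum_i c i *: v i = 0.

(** The spaces of morphisms and the modules come as bare [lmodType]s; a bound on
their dimension is all that is needed of a basis, and it is inherited by
subspaces and quotients at once. *)
Definition dim_le d : Prop := forall v : 'I_d.+1 -> L, dependent v.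

Definition fam_cons d (x : L) (v : 'I_d -> L) : 'I_d.+1 -> L :=
  fun i => oapp v x (unlift ord0 i).

Lemma dependent_cons d (x : L) (v : 'I_d -> L) :
  dependent (fam_cons x v) -> ~ dependent v ->
  exists c : 'I_d -> k, x = \sum_i c i *: v i.
Proof.
move=> [c [[i0 ci0]]]; rewrite big_ord_recl /fam_cons unlift_none /=.
under eq_bigr do rewrite liftK /=.
move=> e nv; have [c0|c0] := eqVneq (c ord0) 0.
  case: nv; exists (fun i => c (lift ord0 i)); split.
    case: (unliftP ord0 i0) ci0 => [j ->|->]; last by rewrite c0 eqxx.
    by exists j.
  by move: e; rewrite c0 scale0r add0r.
exists (fun i => - (c ord0)^-1 * c (lift ord0 i)).
under eq_bigr do rewrite -scalerA.
rewrite -scaler_sumr; move/eqP: e; rewrite addrC addr_eq0 => /eqP ->.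
by rewrite scalerN scaleNr opprK scalerA mulVf ?scale1r.
Qed.

Lemma dim_leS d : dim_le d -> dim_le d.+1.
Proof.
move=> Ld v; have [c [[i ci] e]] := Ld (fun i => v (lift ord0 i)).
exists (fun i => oapp c 0 (unlift ord0 i)); split.
  by exists (lift ord0 i); rewrite liftK.
rewrite big_ord_recl unlift_none scale0r add0r -[RHS]e.
by apply: eq_bigr => j _; rewrite liftK.
Qed.

Lemma dim_le_weaken d d' : (d <= d')%N -> dim_le d -> dim_le d'.
Proof.
by move=> /subnK <-; elim: (d' - d)%N => // n IH /IH; apply: dim_leS.
Qed.

(** A maximal independent family inside P spans P, and the lengths of the
independent families are bounded.  For P the underlying set of a subspace this
says that the subspace is finitely generated. *)
Lemma dim_le_span d (P : L -> Prop) : dim_le d ->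
  exists (m : nat) (v : 'I_m -> L), (forall i, P (v i)) /\
    forall x, P x -> exists c : 'I_m -> k, x = \sum_i c i *: v i.
Proof.
move=> Ld.
pose Q m := `[< exists v : 'I_m -> L, (forall i, P (v i)) /\ ~ dependent v >].
have Q0 : exists m, Q m.
  exists 0%N; apply/asboolP; exists (fun=> 0); split; first by case.
  by case=> c [[[]]].
have Qd m : Q m -> (m <= d)%N.
  move=> /asboolP[v [_ nv]]; rewrite leqNgt; apply/negP => dm; apply: nv.
  by case: m dm v => // m dm v; apply: (dim_le_weaken _ Ld).
case: (ex_maxnP Q0 Qd) => m /asboolP[v [Pv nv]] max.
exists m, v; split=> // x Px; apply: dependent_cons nv.
apply: contrapT => nxv; have := max m.+1; rewrite ltnn.
suff -> : Q m.+1 by move/(_ isT).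
apply/asboolP; exists (fam_cons x v); split=> // i.
by rewrite /fam_cons; case: (unlift ord0 i).
Qed.

(** A decreasing chain of subspaces with zero intersection reaches zero.  The
induction is on the dimension of some member W n: a nonzero x in W n is missing from
some later W m, and adding x to an independent family of W m keeps it independent,
so W m has smaller dimension. *)
Lemma dim_le_chain d (W : nat -> L -> Prop) : dim_le d ->
  (forall n, W n 0) ->
  (forall n a u v, W n u -> W n v -> W n (a *: u + v)) ->
  (forall n m u, (n <= m)%N -> W m u -> W n u) ->
  (forall u, (forall n, W n u) -> u = 0) ->
  exists n, forall u, W n u -> u = 0.
Proof.
move=> Ld W0 WD Wle Wcap.
have Wsum n m (c : 'I_m -> k) (v : 'I_m -> L) :
    (forall i, W n (v i)) -> W n (\sum_i c i *: v i).
  by move=> Wv; elim/big_rec: _ => // i u _ Wu; apply: WD.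
have {Ld} [n Wd] : exists n, forall v : 'I_d.+1 -> L,
  (forall i, W n (v i)) -> dependent v by exists 0%N.
elim: d n Wd => [|d IH] n Wd.
  exists n => u Wu; have [c [[i ci]]] := Wd (fun=> u) (fun=> Wu).
  rewrite big_ord1 => /eqP; rewrite scaler_eq0 => /orP[|/eqP //].
  by rewrite (ord1 i) in ci; rewrite (negbTE ci).
have [//|/existsNP[x /not_implyP[Wx x0]]] := pselect (forall u, W n u -> u = 0).
  by exists n.
have /existsNP[m nWx] : ~ forall m, W m x by move/Wcap.
have nm : (n <= m)%N.
  by rewrite leqNgt; apply/negP => /ltnW mn; exact: nWx (Wle _ _ _ mn Wx).
apply: (IH m) => v Wv; apply: contrapT => nv; apply: nWx.
suff [c ->] : exists c, x = \sum_i c i *: v i by apply: Wsum.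
apply: dependent_cons nv; apply: Wd => i; rewrite /fam_cons.
by case: (unlift ord0 i) => [j|//] /=; apply: (Wle _ m).
Qed.

End FiniteDimension.

Lemma dim_le_inj (k : fieldType) (L M : lmodType k) (f : L -> M) d :
  (forall a u v, f (a *: u + v) = a *: f u + f v) -> injective f ->
  dim_le M d -> dim_le L d.
Proof.
move=> fL fI Md v; have [c [nc e]] := Md (f \o v); exists c; split=> //.
have f0 := lin_map0 fL.
apply: fI; rewrite f0 -[RHS]e; elim/big_rec2: _ => // i y x _ <-.
by rewrite fL.
Qed.

Lemma dim_le_surj (k : fieldType) (V : vectType k) (M : lmodType k) (f : V -> M) :
  (forall a u v, f (a *: u + v) = a *: f u + f v) -> (forall u, exists v, f v = u) ->
  dim_le M (\dim {:V}).
Proof.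
move=> fL fS w; have [v fv] := choice (fun i => fS (w i)).
have f0 := lin_map0 fL.
set n := (\dim _).+1 in w v fv *.
have : ~~ free [tuple v i | i < n].
  apply/negP; rewrite /free size_tuple => /eqP e.
  by have := dimvS (subvf <<[tuple v i | i < n]>>%VS); rewrite e ltnn.
move/freeP => nf; have {nf} /existsNP[c /not_implyP[e /existsNP[i ci]]] := nf.
exists c; split; first by exists i; apply/eqP.
rewrite -f0 -[in RHS]e; elim/big_rec2: _ => // j y x _ ->.
by rewrite fL -fv (nth_map j) ?size_enum_ord // nth_ord_enum.
Qed.

(** * Modules as vector spaces *)

Section HomLinear.
Variables (k : fieldType) (A : falgType k) (X Y : rmod A) (f : rhom X Y).

Lemma rhom_lin a u v : f (a *: u + v) = a *: f u + f v.
Proof. exact: linearP. Qed.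

Lemma rhom_map0 : f 0 = 0. Proof. exact: linear0. Qed.
Lemma rhom_mapB u v : f (u - v) = f u - f v. Proof. exact: linearB. Qed.
Lemma rhom_mapZ a u : f (a *: u) = a *: f u. Proof. exact: linearZ. Qed.
End HomLinear.

Section Scalars.
Variables (k : fieldType) (A : falgType k) (X : rmod A).

(** The vector space underlying a module, by restriction of scalars along
c |-> c 1. *)
Definition restricted : Type := X.
HB.instance Definition _ := GRing.Zmodule.on restricted.
Definition restricted_scale (c : k) (x : restricted) : restricted :=
  (c%:A : A^c) *: (x : X).

Fact restricted_scaleA a b x :
  restricted_scale a (restricted_scale b x) = restricted_scale (a * b) x.
Proof.
rewrite /restricted_scale scalerA; congr (_ *: _).
change ((b%:A : A) * (a%:A : A) = ((a * b)%:A : A)).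
by rewrite mulr_algl scalerA mulrC.
Qed.
Fact restricted_scale1 : left_id 1 restricted_scale.
Proof. by move=> x; rewrite /restricted_scale scale1r; apply: scale1r. Qed.
Fact restricted_scaleDr : right_distributive restricted_scale +%R.
Proof. by move=> a x y; apply: scalerDr. Qed.
Fact restricted_scaleDl x : {morph restricted_scale^~ x : a b / a + b}.
Proof. by move=> a b; rewrite /restricted_scale scalerDl; apply: scalerDl. Qed.
HB.instance Definition _ := GRing.Zmodule_isLmodule.Build k restricted
  restricted_scaleA restricted_scale1 restricted_scaleDr restricted_scaleDl.
End Scalars.

Section FiniteDimensionalModules.
Variables (k : fieldType) (A : falgType k).
Implicit Types X Y : rmod A.

Lemma scale_alg X (c : k) (a : A) (x : X) :
  ((c *: a : A) : A^c) *: x = (c%:A : A^c) *: ((a : A^c) *: x).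
Proof.
rewrite scalerA; congr (_ *: _).
by change (c *: a = (a : A) * (c%:A : A)); rewrite mulr_algr.
Qed.

Lemma restricted_dim_le X : exists d, dim_le (restricted X) d.
Proof.
have [n [g gX]] := rmod_fg X.
pose f (a : {ffun 'I_n -> A}) : restricted X := \sum_i (a i : A^c) *: g i.
exists (\dim {: {ffun 'I_n -> A}}); apply: (@dim_le_surj _ _ _ f) => [c u v|x].
  rewrite /f scaler_sumr -big_split; apply: eq_bigr => i _ /=.
  by rewrite !ffunE scalerDl; congr (_ + _); apply: scale_alg.
have [a ->] := gX x; exists [ffun i => a i].
by apply: eq_bigr => i _; rewrite ffunE.
Qed.

(** A homomorphism is determined by its values on generators of X, and these
values lift to tuples of coefficients in A with respect to generators of Y. *)
Lemma hom_dim_le (X Y : modA A) : exists d, dim_le (hom X Y) d.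
Proof.
have [n [g gX]] := rmod_fg X; have [m [h hY]] := rmod_fg Y.
pose V := {ffun 'I_n -> {ffun 'I_m -> A}}.
pose f (a : V) : {ffun 'I_n -> restricted Y} :=
  [ffun i => \sum_j (a i j : A^c) *: h j].
pose ev (u : hom X Y) : {ffun 'I_n -> restricted Y} := [ffun i => (u : rhom X Y) (g i)].
exists (\dim {: V}); apply: (@dim_le_inj _ _ _ ev) => [c u v|u v e|].
- by apply/ffunP => i; rewrite !ffunE.
- apply: rhomP => x; have [a ->] := gX x; rewrite !linear_sum.
  apply: eq_bigr => i _; rewrite !linearZ; congr (_ *: _).
  by move/ffunP/(_ i): e; rewrite !ffunE.
apply: (@dim_le_surj _ _ _ f) => [c u v|y].
  apply/ffunP => i; rewrite !ffunE scaler_sumr -big_split.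
  apply: eq_bigr => j _ /=.
  by rewrite !ffunE scalerDl; congr (_ + _); apply: scale_alg.
have [a ya] := choice (fun i => hY (y i)).
exists [ffun i => [ffun j => a i j]]; apply/ffunP => i; rewrite ffunE ya.
by apply: eq_bigr => j _; rewrite !ffunE.
Qed.

End FiniteDimensionalModules.

(** * Submodules and quotient modules *)

Section LinearMaps.
Variables (k : fieldType) (A : falgType k) (X Y : rmod A) (f : X -> Y).
Hypothesis f_linear : linear f.

(** The name hides f so that the linear structure can be attached to it. *)
Definition rhom_of_fun : X -> Y := f.
HB.instance Definition _ := GRing.isLinear.Build A^c X Y *:%R rhom_of_fun f_linear.
Definition rhom_of : rhom X Y := (rhom_of_fun : {linear X -> Y}).
End LinearMaps.

(** Linearity of the pointwise lift comes from the injectivity of i. *)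
Lemma lift_injective (k : fieldType) (A : falgType k) (X Y Z : rmod A)
    (i : rhom X Y) (h : rhom Z Y) :
  injective i -> (forall z, exists x, i x = h z) ->
  exists h' : rhom Z X, forall z, i (h' z) = h z.
Proof.
move=> i_inj /choice[h' h'E].
have h'_lin : linear h' by move=> a u v; apply: i_inj; rewrite rhom_lin !h'E rhom_lin.
by exists (rhom_of h'_lin); apply: h'E.
Qed.

Section Submodules.
Variables (k : fieldType) (A : falgType k) (X : rmod A).

Record submodule := Submodule {
  smem :> X -> Prop;
  smem0 : smem 0;
  smem_lin : forall a u v, smem u -> smem v -> smem (a *: u + v)
}.

Variable N : submodule.

Definition smem_pred : {pred X} := fun u => `[< N u >].

Lemma smem_predP u : reflect (N u) (u \in smem_pred).
Proof. exact: asboolP. Qed.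

Fact smem_submod_closed : submod_closed smem_pred.
Proof.
split; first by apply/smem_predP; apply: smem0.
move=> a u v /smem_predP Nu /smem_predP Nv; apply/smem_predP.
exact: smem_lin.
Qed.
HB.instance Definition _ := GRing.isSubmodClosed.Build A^c X smem_pred
  smem_submod_closed.

Record subtype := Subtype { subval : X; _ : subval \in smem_pred }.
HB.instance Definition _ := [isSub for subval].
HB.instance Definition _ := [Choice of subtype by <:].
HB.instance Definition _ := [SubChoice_isSubLmodule of subtype by <:].

(** Submodules are finitely generated because they are finite dimensional. *)
Fact subtype_fg : exists (n : nat) (g : 'I_n -> subtype),
  forall m, exists a : 'I_n -> A^c, m = \sum_i a i *: g i.
Proof.
have [d Xd] := restricted_dim_le X.
have [n [v [Nv vN]]] := dim_le_span (smem N : restricted X -> Prop) Xd.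
exists n, (fun i => Subtype (introT (smem_predP _) (Nv i))) => m.
have [c mc] := vN _ (elimT (smem_predP _) (valP m)).
exists (fun i => ((c i)%:A : A)); apply: val_inj; rewrite mc raddf_sum.
by [].
Qed.
Definition sub_rmod : rmod A := RMod subtype_fg.

Definition incl : rhom sub_rmod X :=
  rhom_of (linearP (val : subtype -> X) : linear (val : sub_rmod -> X)).

Lemma inclP (x : sub_rmod) : N (incl x).
Proof. exact/smem_predP/valP. Qed.

Lemma incl_inj : injective incl.
Proof. exact: val_inj. Qed.

Lemma incl_lift (Z : rmod A) (h : rhom Z X) : (forall z, N (h z)) ->
  exists h' : rhom Z sub_rmod, forall z, incl (h' z) = h z.
Proof.
move=> hN; apply: lift_injective incl_inj _ => z.
by exists (Subtype (introT (smem_predP _) (hN z))).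
Qed.

End Submodules.

Section QuotientModules.
Variables (k : fieldType) (A : falgType k) (X : rmod A) (N : submodule X).

Definition quotient_type := Quotient.quot (smem_pred N).
HB.instance Definition _ := GRing.Zmodule.on quotient_type.
HB.instance Definition _ := EqQuotient.on quotient_type.

Definition class_of (x : X) : quotient_type := \pi_quotient_type x.

Lemma class_ofP u v : (class_of u = class_of v) <-> N (u - v).
Proof.
split=> [e|/smem_predP]; last by rewrite Quotient.idealrBE => /eqP.
by apply/smem_predP; rewrite Quotient.idealrBE; apply/eqP.
Qed.

Lemma class_ofD u v : class_of (u + v) = class_of u + class_of v.
Proof. exact: (Quotient.pi_add (smem_pred N)). Qed.

Lemma class_ofK (u : quotient_type) : class_of (repr u) = u.
Proof. exact: reprK. Qed.

Definition class_scale (a : A^c) (u : quotient_type) := class_of (a *: repr u).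

Lemma class_ofZ a u : class_of (a *: u) = class_scale a (class_of u).
Proof.
apply/esym/class_ofP; rewrite -scalerBr -[_ *: _]addr0.
by apply: smem_lin (smem0 _); apply/class_ofP; rewrite class_ofK.
Qed.

Fact class_scaleA a b u : class_scale a (class_scale b u) = class_scale (a * b) u.
Proof. by rewrite -(class_ofK u) -!class_ofZ scalerA. Qed.
Fact class_scale1 : left_id 1 class_scale.
Proof. by move=> u; rewrite -(class_ofK u) -!class_ofZ scale1r. Qed.
Fact class_scaleDr : right_distributive class_scale +%R.
Proof.
move=> a u v; rewrite -(class_ofK u) -(class_ofK v) -class_ofD -!class_ofZ.
by rewrite -class_ofD scalerDr.
Qed.
Fact class_scaleDl u : {morph class_scale^~ u : a b / a + b}.
Proof.
by move=> a b; rewrite -(class_ofK u) -!class_ofZ -class_ofD scalerDl.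
Qed.
HB.instance Definition _ := GRing.Zmodule_isLmodule.Build A^c quotient_type
  class_scaleA class_scale1 class_scaleDr class_scaleDl.

Fact class_of_linear : linear class_of.
Proof. by move=> a u v; rewrite class_ofD class_ofZ. Qed.

Fact quotient_fg : exists (n : nat) (g : 'I_n -> quotient_type),
  forall m, exists a : 'I_n -> A^c, m = \sum_i a i *: g i.
Proof.
have [n [g gX]] := rmod_fg X; exists n, (class_of \o g) => m.
have [a ma] := gX (repr m); exists a; rewrite -(class_ofK m) ma.
elim/big_rec2: _ => [|i y x _ <-].
  by apply: (addIr (class_of 0)); rewrite -class_ofD !add0r.
exact: class_of_linear.
Qed.
Definition quotient_rmod : rmod A := RMod quotient_fg.

Definition quot_map : rhom X quotient_rmod :=
  rhom_of (class_of_linear : linear (class_of : X -> quotient_rmod)).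

Lemma quot_mapP u v : (quot_map u = quot_map v) <-> N (u - v).
Proof. exact: class_ofP. Qed.

Lemma quot_map_surj : surjective quot_map.
Proof. by move=> u; exists (repr u); apply: class_ofK. Qed.

Section Factorization.
Variables (Z : rmod A) (h : rhom X Z) (hN : forall x, N x -> h x = 0).

Definition quot_fact_fun (u : quotient_rmod) : Z := h (repr (u : quotient_type)).

Lemma quot_fact_funE x : quot_fact_fun (quot_map x) = h x.
Proof.
have /hN : N (repr (class_of x) - x) by apply/class_ofP; rewrite class_ofK.
by rewrite linearB => /subr0_eq.
Qed.

Fact quot_fact_linear : linear quot_fact_fun.
Proof.
move=> a u v; have [x <-] := quot_map_surj u; have [y <-] := quot_map_surj v.
by rewrite -linearP !quot_fact_funE linearP.
Qed.
Definition quot_fact : rhom quotient_rmod Z := rhom_of quot_fact_linear.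

Lemma quot_factE x : quot_fact (quot_map x) = h x.
Proof. exact: quot_fact_funE. Qed.
End Factorization.

End QuotientModules.

(** * Indecomposable modules *)

(** The powers of f are linearly dependent, so p(f) = 0 for some nonzero
polynomial p, which splits into linear factors.  If all the f - c were invertible,
they could be cancelled one after the other, until p is a nonzero constant. *)
Lemma exists_eigenvalue (k : closedFieldType) (C : kcat k) (x : C) (f : hom x x) d :
  dim_le (hom x x) d -> ~ is_zero x -> exists c : k, ~ is_iso (f - c *: idm x).
Proof.
move=> Ld nz; apply: contrapT => /forallNP iso.
have {}iso c : is_iso (f - c *: idm x) by apply: contrapT.
pose pow i := iter i (comp f) (idm x).
(* [ev n p] is p(f) as soon as n bounds the size of p; a bound that does not
   depend on p makes the sum additive in p. *)
pose ev n (p : {poly k}) := \sum_(i < n) p`_i *: pow i.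
have evM n a (q : {poly k}) : (size q <= n)%N ->
    ev n.+1 (q * ('X - a%:P)) = (f - a *: idm x) \oc ev n q.
  move=> sq; rewrite compBl compZl comp_idl comp_sumr /ev.
  under eq_bigr do rewrite mulrBr coefB coefMX coefMC scalerBl mulrC -scalerA.
  rewrite sumrB -scaler_sumr; congr (_ - _ *: _).
    rewrite big_ord_recl eqxx scale0r add0r.
    by apply: eq_bigr => i _; rewrite compZr.
  by rewrite big_ord_recr /= nth_default // scale0r addr0.
have ev_neq0 n (p : {poly k}) : p != 0 -> (size p <= n)%N -> ev n p <> 0.
  elim: n p => [|n IH] p p0 sp; first by rewrite size_poly_leq0 (negbTE p0) in sp.
  have [s1|s1] := eqVneq (size p) 1%N.
    move: p0 {sp}; have [c c0 ->] := size_poly1P _ (introT eqP s1) => _.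
    rewrite /ev big_ord_recl big1 => [|i _]; rewrite coefC ?scale0r //= addr0.
    by move/eqP; rewrite scaler_eq0 (negbTE c0) => /eqP.
  have [a /factor_theorem[q pq]] := closed_rootP p s1.
  have q0 : q != 0 by apply: contraNneq p0 => q0; rewrite pq q0 mul0r.
  have sq : (size q <= n)%N.
    by move: sp; rewrite pq size_Mmonic ?monicXsubC // size_XsubC addn2.
  rewrite pq evM // => e; apply: (IH q) => //; have [g [gf _]] := iso a.
  by rewrite -(comp_idl (ev n q)) -gf -compA e comp0r.
have [c [[i ci] e]] := Ld (fun i => pow i).
pose p := \poly_(j < d.+1) oapp c 0 (insub j).
have pE (j : 'I_d.+1) : p`_j = c j by rewrite coef_poly ltn_ord valK.
apply: (ev_neq0 d.+1 p); rewrite ?size_poly //.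
  by apply: contraNneq ci => p0; rewrite -pE p0 coef0.
by rewrite -[RHS]e; apply: eq_bigr => j _; rewrite pE.
Qed.

Section AlmostSplit.
Variables (k : fieldType) (A : falgType k).
Implicit Types X Y Z E T : modA A.

Local Notation "f $$ x" := (rhom_fun (f : rhom _ _) x) (at level 15).

Lemma homP X Y (f g : hom X Y) : (forall x, f $$ x = g $$ x) -> f = g.
Proof. exact: rhomP. Qed.

Lemma hom_appE X Y (f g : hom X Y) x : f = g -> f $$ x = g $$ x.
Proof. by move=> ->. Qed.

Lemma is_iso_inj X Y (f : hom X Y) : is_iso f -> injective (rhom_fun f).
Proof.
case=> g [gf _] x y e; have E z : g $$ (f $$ z) = z := hom_appE z gf.
by rewrite -(E x) e E.
Qed.

Lemma nonzero_elt X : ~ is_zero X -> exists x : X, x != 0.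
Proof.
move=> nz; apply: contrapT => /forallNP H; apply: nz; apply: homP => x.
by apply/eqP; apply: contrapT => /negP; apply: H.
Qed.

Definition kernel X Y (f : hom X Y) : submodule X.
Proof.
exists (fun x => f $$ x = 0) => [|a u v]; first exact: rhom_map0.
by move=> /= fu fv; rewrite rhom_lin fu fv scaler0 addr0.
Defined.

Definition range X Y (f : hom X Y) : submodule Y.
Proof.
exists (fun y => exists x, f $$ x = y) => [|a _ _ [x <-] [x' <-]].
  by exists 0; apply: rhom_map0.
by exists (a *: x + x'); rewrite rhom_lin.
Defined.

(** A retraction g of f exhibits Y as the direct sum of X and the kernel of g, so
that the kernel is zero. *)
Lemma split_mono_indecomposable X Y (f : hom X Y) :
  indecomposable X -> indecomposable Y -> split_mono f -> is_iso f.
Proof.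
move=> [X0 _] [_ Yind] [g gf].
have gfx x : g $$ (f $$ x) = x := hom_appE x gf.
pose i : hom (sub_rmod (kernel g) : modA A) Y := incl (kernel g).
have [p pE] : exists p : hom Y (sub_rmod (kernel g) : modA A),
    forall y, i $$ (p $$ y) = (idm Y - f \oc g) $$ y.
  apply: (@incl_lift _ _ _ (kernel g)) => y.
  by change (g $$ (y - f $$ (g $$ y)) = 0); rewrite rhom_mapB gfx subrr.
have ip : i \oc p = idm Y - f \oc g by apply: homP.
have gi : g \oc i = 0 by apply: homP => x; apply: (inclP x).
have ii (Z : modA A) (u v : hom Z (sub_rmod (kernel g) : modA A)) :
    i \oc u = i \oc v -> u = v.
  move=> e; apply: homP => z; apply: incl_inj.
  by have : (i \oc u) $$ z = (i \oc v) $$ z by rewrite e.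
pose Xs b : modA A := if b then X else sub_rmod (kernel g).
pose inj b : hom (Xs b) Y := match b with true => f | false => i end.
pose proj b : hom Y (Xs b) := match b with true => g | false => p end.
have D : is_direct_sum inj proj.
  split=> [[]|[] []|] //=.
  - by apply: ii; rewrite compA ip compBl comp_idl -compA gi comp0r subr0 comp_idr.
  - by move=> _; apply: ii; rewrite compA ip compBl comp_idl -compA gf comp_idr subrr comp0r.
  - by rewrite big_bool; change (f \oc g + i \oc p = idm Y); rewrite ip addrC subrK.
case: (Yind _ _ _ D) => // K0; exists g; split=> //.
apply/esym/eqP; rewrite -subr_eq0 -ip -[p]comp_idl.
by rewrite (K0 : idm (sub_rmod (kernel g) : modA A) = 0) comp0l comp0r.
Qed.

(** * Almost split maps and their kernels *)

Definition reg1 : regular A := (1 : A).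

Lemma reg1E (a : regular A) : (a : A^c) *: reg1 = a.
Proof. exact: (@mulr1 A^c). Qed.

Section Orbit.
Variables (Y : modA A) (y : Y).
Definition orbit_fun (a : regular A) : Y := (a : A^c) *: y.
Fact orbit_linear : linear orbit_fun.
Proof. by move=> b a a'; rewrite /orbit_fun scalerDl -scalerA. Qed.
Definition orbit_map : hom (regular A : modA A) Y := rhom_of orbit_linear.
End Orbit.

Lemma retract_regular_projective Y (p : hom (regular A : modA A) Y) :
  split_epi p -> projective Y.
Proof.
move=> [s ps] X Z q f q_surj; have [x qx] := q_surj (f $$ (p $$ reg1)).
exists (orbit_map x \oc s); apply: homP => y.
change (q $$ ((s $$ y : A^c) *: x) = f $$ y).
rewrite rhom_mapZ qx -!rhom_mapZ reg1E.
by rewrite (hom_appE y ps : p $$ (s $$ y) = y).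
Qed.

(** If 0 : E -> Y is right almost split, then every nonzero map to Y is a split
epimorphism.  Applied to a |-> y a with y nonzero, this makes Y a direct summand of
the regular module. *)
Lemma zero_right_almost_split_projective E Y :
  ~ is_zero Y -> right_minimal_almost_split (0 : hom E Y) -> projective Y.
Proof.
move=> /nonzero_elt[y y0] [_ fact _].
have [|ns] := pselect (split_epi (orbit_map y)); first exact: retract_regular_projective.
have [h e] := fact _ _ ns; case/eqP: y0.
have : orbit_map y $$ reg1 = 0 by rewrite e comp0l.
by rewrite -[RHS]/(0 : Y) => <-; apply/esym/scale1r.
Qed.

(** As Y is projective, g is not surjective, so the inclusion of its range is not a
split epimorphism and factors through g.  Hence g = g h p with p the
corestriction of g; by minimality h p is an isomorphism, and p is injective. *)
Lemma right_almost_split_projective_inj E Y (g : hom E Y) :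
  projective Y -> right_minimal_almost_split g -> injective (rhom_fun g).
Proof.
move=> Yp [ns fact min].
pose i : hom (sub_rmod (range g) : modA A) Y := incl (range g).
have [p pE] : exists p : hom E (sub_rmod (range g) : modA A),
    forall x, i $$ (p $$ x) = g $$ x.
  by apply: (@incl_lift _ _ _ (range g)) => x; exists x.
have [h ih] : exists h, i = g \oc h.
  apply: fact => -[s is1]; apply: ns; apply: Yp => y.
  have [x gx] := inclP (s $$ y); exists x; rewrite gx.
  exact: (hom_appE y is1).
have hp_iso : is_iso (h \oc p).
  by apply: min; rewrite compA -ih; apply: homP => x; apply: pE.
move=> x x' e; apply: (is_iso_inj hp_iso); congr (h $$ _).
by apply: incl_inj; rewrite -!/(i $$ _) !pE.
Qed.

(** Let K be the kernel of g, with inclusion j, and let f' : T -> K be the map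
induced by f.  First, f' is a split monomorphism: otherwise f' = t f, so j t is an
isomorphism by minimality of f, K is all of E and g = 0, which only happens for
projective Y.  Let r be a retraction of f', and N its kernel; N = 0 has to be
shown, since r is then inverse to f'.  The map g induces g' : E/N -> Y.  If g' is
not a split epimorphism, then it factors through g, and minimality of g makes
E -> E/N injective.  If g' has a section s, then E/N is the direct sum of s(Y) and
the kernel K/N of g', which is a copy of T; the projection to it restricts
to a retraction of f, which is impossible. *)
Lemma almost_split_weak_kernel T E Y (f : hom T E) (g : hom E Y) :
  ~ is_zero Y -> ~ projective Y ->
  left_minimal_almost_split f -> right_minimal_almost_split g -> g \oc f = 0 ->
  forall Z (h : hom Z E), g \oc h = 0 -> exists w : hom Z T, h = f \oc w.
Proof.
move=> Y0 Yp f_las g_ras gf; case: (f_las) (g_ras) => [nf Lf Mf] [_ Rg Mg].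
pose K : modA A := sub_rmod (kernel g); pose j : hom K E := incl (kernel g).
have j_inj : injective (rhom_fun j) by apply: incl_inj.
have gj (x : K) : g $$ (j $$ x) = 0 by apply: (@inclP _ _ _ (kernel g) x).
have gj0 : g \oc j = 0 by apply: homP => x; apply: gj.
have to_K Z (h : hom Z E) : g \oc h = 0 -> exists h' : hom Z K, j \oc h' = h.
  move=> gh; have [h' h'E] : exists h' : hom Z K, forall z, j $$ (h' $$ z) = h $$ z.
    by apply: (@incl_lift _ _ _ (kernel g)) => z; apply: (hom_appE z gh).
  by exists h'; apply: homP.
have [f' jf'] := to_K _ _ gf.
have jf'E t : j $$ (f' $$ t) = f $$ t by rewrite -jf'.
have [r rf'] : split_mono f'.
  apply: contrapT => /Lf[t tf].
  have [s [_ js]] : is_iso (j \oc t) by apply: Mf; rewrite -compA -tf.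
  have g0 : g = 0.
    by rewrite -[g]comp_idr -js -!compA compA gj0 comp0l.
  by apply: Yp; apply: (@zero_right_almost_split_projective E); rewrite // -g0.
have rf'E t : r $$ (f' $$ t) = t := hom_appE t rf'.
suff r_inj : forall x, r $$ x = 0 -> x = 0.
  move=> Z h /to_K[h' <-]; exists (r \oc h'); rewrite -jf' -compA.
  congr (j \oc _); apply: homP => z; apply/esym/subr0_eq/r_inj.
  change (r $$ (f' $$ (r $$ (h' $$ z)) - h' $$ z) = 0).
  by rewrite rhom_mapB rf'E subrr.
pose N_mem (x : E) := exists2 y : K, j $$ y = x & r $$ y = 0.
have N0 : N_mem 0 by exists 0; apply: rhom_map0.
have N_lin a u v : N_mem u -> N_mem v -> N_mem (a *: u + v).
  move=> [x <- rx] [y <- ry]; exists (a *: x + y); first exact: rhom_lin.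
  by rewrite rhom_lin rx ry scaler0 addr0.
pose N := Submodule N0 N_lin.
pose C : modA A := quotient_rmod N; pose c : hom E C := quot_map N.
have N_ker x : N x -> g $$ x = 0 by case=> y <- _; apply: gj.
pose g' : hom C Y := quot_fact N_ker.
have g'c : g' \oc c = g by apply: homP => x; apply: quot_factE.
have [[s g's]|ns] := pselect (split_epi g').
  case: nf.
  (* i identifies T with K/N, where the projection c - s g takes its values. *)
  pose i := c \oc f.
  have i_inj : injective (rhom_fun i).
    move=> t t' /quot_mapP[y]; rewrite -rhom_mapB -jf'E => /j_inj -> /eqP.
    by rewrite rf'E subr_eq0 => /eqP.
  have [p pE] : exists p : hom E T, forall x, i $$ (p $$ x) = (c - s \oc g) $$ x.
    apply: lift_injective i_inj _ => x; have [z cz] := quot_map_surj ((c - s \oc g) $$ x).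
    have gz : g $$ z = 0.
      have -> : g $$ z = (g' \oc (c - s \oc g)) $$ x.
        by change (g $$ z = g' $$ ((c - s \oc g) $$ x)); rewrite -cz -g'c.
      by rewrite compBr g'c compA g's comp_idl subrr.
    pose y : K := Subtype (introT (smem_predP (kernel g) z) gz).
    exists (r $$ y); rewrite -cz; apply/quot_mapP.
    exists (f' $$ (r $$ y) - y); first by rewrite rhom_mapB jf'E.
    by rewrite rhom_mapB rf'E subrr.
  exists p; apply: homP => t; apply: i_inj.
  change (i $$ (p $$ (f $$ t)) = i $$ t); rewrite pE.
  change (c $$ (f $$ t) - s $$ ((g \oc f) $$ t) = i $$ t).
  by rewrite gf [s $$ _]rhom_map0 subr0.
have [s g's] := Rg _ _ ns.
have sc_iso : is_iso (s \oc c) by apply: Mg; rewrite compA -g's.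
move=> x rx; apply: j_inj; apply: (is_iso_inj sc_iso).
rewrite [j $$ 0]rhom_map0; congr (s $$ _); apply/quot_mapP.
by exists x; rewrite ?subr0.
Qed.

End AlmostSplit.

(** * Lengths of paths *)

Section Truncation.
Variables (k : fieldType) (V : Type) (arr : V -> V -> finType).
Local Notation P := (path_kcat k arr).

Fixpoint plen x y (p : qpath arr x y) : nat :=
  if p is PCons _ _ _ _ q then (plen q).+1 else 0.

Lemma plen_cat x y z (q : qpath arr y z) (p : qpath arr x y) :
  plen (pcat q p) = (plen q + plen p)%N.
Proof. by elim: q p => //= ? ? ? a q IH p; rewrite IH. Qed.

Definition trunc n (x y : P) (f : hom x y) : hom x y :=
  [malg p in msupp (f : khom k arr x y) => if (plen p < n)%N then f@_p else 0].

Lemma mcoeff_trunc n (x y : P) (f : khom k arr x y) p :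
  (trunc n (f : hom (x : P) y) : khom k arr x y)@_p =
  if (plen p < n)%N then f@_p else 0.
Proof.
by rewrite mcoeffE; case: (msuppP f p) => //; rewrite if_same.
Qed.

Lemma trunc_zero (x y : P) (f : hom x y) : trunc 0 f = 0.
Proof.
by apply/(@malgP (qpath arr x y) k) => p; rewrite mcoeff_trunc ltn0 mcoeff0.
Qed.

Lemma trunc_lin n (x y : P) a (f g : hom x y) :
  trunc n (a *: f + g) = a *: trunc n f + trunc n g.
Proof.
apply/(@malgP (qpath arr x y) k) => p.
rewrite [LHS]mcoeff_trunc (@mcoeffD (qpath arr x y) k) (@mcoeffZ (qpath arr x y) k).
rewrite [RHS](@mcoeffD (qpath arr x y) k) (@mcoeffZ (qpath arr x y) k) !mcoeff_trunc.
by case: ifP => //; rewrite mulr0 addr0.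
Qed.

Lemma trunc0 n (x y : P) : trunc n (0 : hom x y) = 0.
Proof. exact: lin_map0 (@trunc_lin n x y). Qed.

Lemma truncD n (x y : P) (f g : hom x y) :
  trunc n (f + g) = trunc n f + trunc n g.
Proof. by have := trunc_lin n 1 f g; rewrite !scale1r. Qed.

Lemma trunc_sum n (x y : P) (I : finType) (f : I -> hom x y) :
  trunc n (\sum_i f i) = \sum_i trunc n (f i).
Proof. by apply: (big_morph (trunc n (y:=y))) => [u v|]; rewrite ?truncD ?trunc0. Qed.

Lemma path_kcat_ind (x y : P) (Q : hom x y -> Prop) :
  Q 0 -> (forall a (p : qpath arr x y) u, Q u -> Q (a *: (kpath k p : hom x y) + u)) ->
  forall u, Q u.
Proof. exact: khom_ind. Qed.

Lemma trunc_path n x y (p : qpath arr x y) :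
  trunc n (kpath k p : hom (x : P) y) = if (plen p < n)%N then kpath k p else 0.
Proof.
apply/(@malgP (qpath arr x y) k) => q; rewrite mcoeff_trunc [in LHS]mcoeffU.
have [<-|pq] := eqVneq p q; first by case: ifP; rewrite ?mcoeffUU ?mcoeff0.
by rewrite if_same; case: ifP; rewrite ?mcoeff0 // mcoeffU (negbTE pq).
Qed.

Lemma path_kcat_linear_ext (x y : P) (M : lmodType k) (u v : hom x y -> M) :
  (forall a f g, u (a *: f + g) = a *: u f + u g) ->
  (forall a f g, v (a *: f + g) = a *: v f + v g) ->
  (forall p : qpath arr x y, u (kpath k p : hom x y) = v (kpath k p : hom x y)) ->
  forall f, u f = v f.
Proof.
move=> ul vl uv; elim/path_kcat_ind => [|a p f IH].
  by rewrite (lin_map0 ul) (lin_map0 vl).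
by rewrite ul vl uv IH.
Qed.

(** Truncated subtraction is right here: if q has length at least n, then both
sides are zero. *)
Lemma trunc_comp_pathl n x y z (q : qpath arr y z) (f : hom (x : P) y) :
  trunc n ((kpath k q : hom (y : P) z) \oc f) =
  (kpath k q : hom (y : P) z) \oc trunc (n - plen q) f.
Proof.
move: f; apply: path_kcat_linear_ext => [a f g|a f g|p].
- by rewrite comp_linr trunc_lin.
- by rewrite trunc_lin comp_linr.
rewrite [_ \oc _]kcomp_path !trunc_path plen_cat -ltn_subRL.
by case: ifP => _; rewrite ?comp0r // [RHS]kcomp_path.
Qed.

Lemma trunc_comp_pathr n x y z (g : hom (y : P) z) (p : qpath arr x y) :
  trunc n (g \oc (kpath k p : hom (x : P) y)) =
  trunc (n - plen p) g \oc (kpath k p : hom (x : P) y).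
Proof.
move: g; apply: path_kcat_linear_ext => [a f g|a f g|q].
- by rewrite comp_linl trunc_lin.
- by rewrite trunc_lin comp_linl.
rewrite [_ \oc _]kcomp_path !trunc_path plen_cat addnC -ltn_subRL.
by case: ifP => _; rewrite ?comp0l // [RHS]kcomp_path.
Qed.

Lemma trunc_large (x y : P) (f : hom x y) : exists n, trunc n f = f.
Proof.
suff [n nf] : exists n, forall m, (n <= m)%N -> trunc m f = f by exists n; apply: nf.
elim/path_kcat_ind: f => [|a p f [n nf]]; first by exists 0%N => m _; apply: trunc0.
exists (maxn n (plen p).+1) => m; rewrite geq_max => /andP[nm pm].
by rewrite trunc_lin trunc_path pm; congr (_ + _); apply: nf.
Qed.

(** An ideal generated by homogeneous relations is graded.  Closure under
truncation is a convenient way to express this, since truncations commute with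
composition up to a shift of the bound. *)
Lemma ideal_span_trunc (R : hom_family P) :
  (forall n (x y : P) (u : hom x y), R x y u -> ideal_span R (trunc n u)) ->
  forall n (x y : P) (u : hom x y), ideal_span R u -> ideal_span R (trunc n u).
Proof.
move=> homog n x y u Ru; elim: Ru n => {x y u}.
- by move=> x y u /homog.
- by move=> x y n; rewrite trunc0; apply: Span0.
- by move=> x y a u v _ IHu _ IHv n; rewrite trunc_lin; apply: Span_lin.
- move=> x y z g f _ IH n; elim/path_kcat_ind: g => [|a q g IHg].
    by rewrite comp0l trunc0; apply: Span0.
  rewrite comp_linl trunc_lin; apply: Span_lin; last exact: IHg.
  by rewrite trunc_comp_pathl; apply: Span_compl.
- move=> x y z g f _ IH n; elim/path_kcat_ind: f => [|a p f IHf].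
    by rewrite comp0r trunc0; apply: Span0.
  rewrite comp_linr trunc_lin; apply: Span_lin; last exact: IHf.
  by rewrite trunc_comp_pathr; apply: Span_compr.
Qed.

Lemma path_last_arrow x y (p : qpath arr x y) :
  (exists E : x = y, p = ecast z (qpath arr x z) E (PNil arr x)) \/
  exists (t : {z : V & arr z y}) (q : qpath arr x (tag t)), p = PCons (tagged t) q.
Proof.
case: p => [{}x|{}x z {}y b q]; first by left; exists erefl.
by right; exists (Tagged (fun z => arr z y) b), q.
Qed.

(** A combination of paths is its part e of length zero plus paths that end with
one of the arrows to y.  The part e lives in k.1 if x = y and is zero otherwise;
the alternative in the conclusion says so without an equation between vertices. *)
Lemma path_kcat_last_arrow (x y : P) (r : nat)
    (alpha : 'I_r -> {z : V & arr z y}) (f : hom x y) : bijective alpha ->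
  exists (e : hom x y) (g : forall i, hom x (tag (alpha i) : P)),
    f = e + \sum_i (karrow k (tagged (alpha i)) : hom (tag (alpha i) : P) y) \oc g i /\
    (e = 0 \/ is_iso e).
Proof.
move=> [beta ab ba].
have [e [g [-> He]]] : exists (e : hom x y) (g : forall i, hom x (tag (alpha i) : P)),
    f = e + \sum_i (karrow k (tagged (alpha i)) : hom (tag (alpha i) : P) y) \oc g i /\
    (e = 0 \/ exists (a : k) (E : x = y), e = a *: (ecast z (hom x z) E (idm x))).
  elim/path_kcat_ind: f => [|a p f [e [g [-> He]]]].
    exists 0, (fun=> 0); split; last by left.
    by rewrite add0r big1 // => i _; rewrite comp0r.
  have [[E pE]|[t]] := path_last_arrow p.
    exists (a *: (kpath k p : hom x y) + e), g; rewrite addrA; split=> //.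
    right; have {pE} pE : (kpath k p : hom x y) = ecast z (hom x z) E (idm x).
      by rewrite pE; case: y / E {beta ab ba e g He alpha p f pE}.
    case: He => [->|[b [E' ->]]]; first by exists a, E; rewrite addr0 pE.
    by exists (a + b), E; rewrite pE (Prop_irrelevance E' E) scalerDl.
  rewrite -(ba t); move: (beta t) => i [q ->].
  exists e, (dfwith g (g i + a *: (kpath k q : hom x (tag (alpha i) : P)))); split=> //.
  rewrite addrCA; congr (e + _); rewrite (bigD1 i) // [in RHS](bigD1 i) // dfwith_in.
  rewrite compDr compZr [karrow k _ \oc kpath k q]kcomp_path addrCA addrA.
  congr (_ + _).
  by apply: eq_bigr => j ji; rewrite dfwith_out // eq_sym.
exists e, g; split=> //; case: He => [|[a [E ->]]]; first by left.
have [->|a0] := eqVneq a 0; first by left; rewrite scale0r.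
right; case: y / E {alpha beta ab ba f e g}; exists (a^-1 *: idm x).
split; rewrite compZl comp_idl scalerA ?mulVf ?mulfV ?scale1r //.
Qed.
End Truncation.

(** * Riedtmann functors on generalized standard components *)

Lemma kfunctor_eq (k : fieldType) (C D : kcat k) (o : C -> D)
    (m m' : forall x y, hom x y -> hom (o x) (o y)) l l' i i' c c' :
  (forall x y (f : hom x y), m x y f = m' x y f) ->
  @KFunctor k C D o m l i c = @KFunctor k C D o m' l' i' c'.
Proof.
move=> mm'; have {mm'} E : m = m'.
  by apply: functional_extensionality_dep => x;
     apply: functional_extensionality_dep => y;
     apply: functional_extensionality_dep => f.
by case: m' / E in l' i' c' *; congr KFunctor; apply: Prop_irrelevance.
Qed.

Section Comparison.
Variables (k : closedFieldType) (A : falgType k) (G : ar_component A).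
Local Notation PG := (path_category G).
Local Notation MG := (mesh_category G).
Local Notation J := (generated_ideal (@mesh_relation k A G)).

(* A Riedtmann functor fixes the vertices.  It is given here by its action Fm on
   morphisms, with the identity as its action on objects, so that Fm u is a
   morphism from x to y on the nose. *)
Variable Fm : forall x y : MG, hom x y -> hom (vmod x) (vmod y).
Hypothesis Fm_lin : forall (x y : MG) a (f g : hom x y), Fm (a *: f + g) = a *: Fm f + Fm g.
Hypothesis Fm_id : forall x : MG, Fm (idm x) = idm (vmod x).
Hypothesis Fm_comp : forall (x y z : MG) (g : hom y z) (f : hom x y),
  Fm (g \oc f) = Fm g \oc Fm f.
Let F : kfunctor MG (ind_category G) :=
  @KFunctor k MG (ind_category G) (fun x => x) Fm Fm_lin Fm_id Fm_comp.
Hypothesis FR : Riedtmann F.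
Hypothesis G_gs : generalized_standard G.

(** The functor on the path category that is induced by F.  Lengths of paths make
sense there, but not for morphisms of the mesh category. *)
Definition Phi (x y : PG) (u : hom x y) : hom (vmod x) (vmod y) := Fm (qpi J u).

Lemma Phi_lin (x y : PG) a (u v : hom x y) : Phi (a *: u + v) = a *: Phi u + Phi v.
Proof. by rewrite /Phi qpi_lin Fm_lin. Qed.

Lemma Phi_id (x : PG) : Phi (idm x) = idm (vmod x).
Proof. exact: Fm_id. Qed.

Lemma Phi_comp (x y z : PG) (v : hom y z) (u : hom x y) :
  Phi (v \oc u) = Phi v \oc Phi u.
Proof. by rewrite /Phi -qcompE Fm_comp. Qed.

Lemma Phi0 (x y : PG) : Phi (0 : hom x y) = 0.
Proof. exact: lin_map0 (@Phi_lin x y). Qed.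

Lemma PhiD (x y : PG) (u v : hom x y) : Phi (u + v) = Phi u + Phi v.
Proof. by have := Phi_lin 1 u v; rewrite !scale1r. Qed.

Lemma PhiB (x y : PG) (u v : hom x y) : Phi (u - v) = Phi u - Phi v.
Proof. by rewrite addrC -scaleN1r Phi_lin scaleN1r addrC. Qed.

Lemma PhiZ (x y : PG) a (u : hom x y) : Phi (a *: u) = a *: Phi u.
Proof. by have := Phi_lin a u 0; rewrite Phi0 !addr0. Qed.

Lemma Phi_sum (x y : PG) (I : finType) (u : I -> hom x y) :
  Phi (\sum_i u i) = \sum_i Phi (u i).
Proof. by apply: (big_morph (@Phi x y)) => [v w|]; rewrite ?PhiD ?Phi0. Qed.

Lemma Phi_J (x y : PG) (u : hom x y) : imem J u -> Phi u = 0.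
Proof.
move=> Ju; rewrite -(Phi0 x y) /Phi; congr (Fm _).
by apply/qpiP; rewrite subr0.
Qed.

Lemma Phi_iso (x y : PG) (u : hom x y) : is_iso u -> is_iso (Phi u).
Proof.
by case=> v [vu uv]; exists (Phi v); rewrite -!Phi_comp vu uv !Phi_id.
Qed.

(** If one component were an isomorphism, the left almost split map would be a
split monomorphism. *)
Lemma Phi_arrow_rad (x : G) (r : nat) (alpha : 'I_r -> arrows_from x) (S : modA A)
    (inj : forall i, hom (vmod (tag (alpha i))) S)
    (proj : forall i, hom S (vmod (tag (alpha i)))) :
  is_direct_sum inj proj ->
  left_minimal_almost_split
    (\sum_i inj i \oc Phi (karrow k (tagged (alpha i)) : hom (x : PG) (tag (alpha i)))) ->
  forall i, rad (Phi (karrow k (tagged (alpha i)) : hom (x : PG) (tag (alpha i)))).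
Proof.
move=> D [ns _ _] i; apply: rad_indecomposable; try exact: vmod_indecomposable.
case=> b [bP _]; apply: ns; exists (b \oc proj i).
by rewrite -compA (proj_sum_inj D).
Qed.

(** The induction peels off arrows at the source of f, by left almost split maps,
since rad^(n+1) is defined as rad^n rad, with the factor in rad applied first. *)
Lemma Phi_full_mod_rad n (x y : PG) (f : hom (vmod x) (vmod y)) :
  exists u : hom x y, rad_pow n (f - Phi u).
Proof.
elim: n x y f => [|n IH] x y f; first by exists 0.
have nonsplit (z : PG) (g : hom (vmod x) (vmod z)) : ~ is_iso g ->
    exists u : hom x z, rad_pow n.+1 (g - Phi u).
  move=> ng; have [r [alpha [S [inj [proj [_ D las]]]]]] := Riedtmann_left FR x.
  have arad := Phi_arrow_rad D las; case: (las) => _ fact _.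
  have [h gh] : exists h : hom S (vmod z), g = h \oc
      \sum_i inj i \oc Phi (karrow k (tagged (alpha i)) : hom (x : PG) (tag (alpha i))).
    apply: fact => sg; apply/ng/split_mono_indecomposable => //;
    exact: vmod_indecomposable.
  pose u i := sval (cid (IH (tag (alpha i)) z (h \oc inj i))).
  have uE i : rad_pow n (h \oc inj i - Phi (u i)) := svalP (cid (IH _ _ _)).
  exists (\sum_i u i \oc (karrow k (tagged (alpha i)) : hom (x : PG) (tag (alpha i)))).
  exists r, (fun i => vmod (tag (alpha i))), (fun i => h \oc inj i - Phi (u i)),
    (fun i => Phi (karrow k (tagged (alpha i)) : hom (x : PG) (tag (alpha i)))).
  split=> //; rewrite gh comp_sumr Phi_sum -sumrB; apply: eq_bigr => i _.
  by rewrite Phi_comp compBl compA.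
have [f_iso|] := pselect (is_iso f); last exact: nonsplit.
have E : x = y by apply: vmod_inj; exists f.
subst y; have [d Hd] := hom_dim_le (vmod x) (vmod x).
have [c /nonsplit[u uE]] := exists_eigenvalue f Hd (vmod_indecomposable x).1.
exists (u + c *: idm x).
suff -> : f - Phi (u + c *: idm x) = f - c *: idm (vmod x) - Phi u by [].
by rewrite PhiD PhiZ Phi_id opprD addrA addrAC.
Qed.

Lemma Phi_full (x y : PG) (f : hom (vmod x) (vmod y)) : exists u : hom x y, Phi u = f.
Proof.
have [d Hd] := hom_dim_le (vmod x) (vmod y).
have [n rad0] : exists n, forall g : hom (vmod x) (vmod y), rad_pow n g -> g = 0.
  apply: (dim_le_chain Hd) => [n|n a u v|n p u|u].
  - exact: (rad_pow_closed n _ _).1.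
  - exact: (rad_pow_closed n _ _).2.
  - exact: rad_pow_anti.
  - exact: G_gs.
have [u /rad0/subr0_eq ->] := Phi_full_mod_rad n f.
by exists u.
Qed.

(** The condition on a Riedtmann functor gives one enumeration of the arrows and
one direct sum; here they are arbitrary.  This allows the direct sum chosen for the
arrows ending at x to be used for the arrows starting at tau x. *)
Lemma Phi_left_minimal_almost_split (x : G) (r : nat) (gam : 'I_r -> arrows_from x)
    (S : modA A) (inj : forall i, hom (vmod (tag (gam i))) S)
    (proj : forall i, hom S (vmod (tag (gam i)))) :
  bijective gam -> is_direct_sum inj proj ->
  left_minimal_almost_split (\sum_i inj i \oc
    Phi (karrow k (tagged (gam i)) : hom (x : PG) (tag (gam i)))).
Proof.
move=> gam_bij D.
have [r' [beta [S' [inj' [proj' [[b bb' b'b] D' las]]]]]] := Riedtmann_left FR x.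
have [p [p_bij pE]] : exists p : 'I_r -> 'I_r', bijective p /\
    gam = (fun i => beta (p i)).
  exists (fun i => b (gam i)); split; last by apply/funext => i; rewrite b'b.
  exact: bij_comp (Bijective b'b bb') gam_bij.
subst gam; have th_iso := direct_sum_reindex p_bij D' D.
have := left_minimal_almost_split_iso th_iso las.
rewrite comp_suml; congr left_minimal_almost_split; apply: eq_bigr => j _.
by rewrite -compA (proj_sum_inj D').
Qed.

Section MeshExactness.
Variables (x : G) (Nx : ~ projective (vmod x)).

Definition sigma_arrow (t : arrows_to x) : arrows_from (tau Nx) :=
  Tagged (fun y => arrow (tau Nx) y) (sigma Nx (tagged t)).

Lemma sigma_arrow_bij : bijective sigma_arrow.
Proof.
have inv_ex y : exists g : arrow (tau Nx) y -> arrow y x,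
    cancel (sigma Nx (y:=y)) g /\ cancel g (sigma Nx (y:=y)).
  by case: (sigma_bij Nx y) => g a b; exists g.
pose inv y := sval (cid (inv_ex y)).
have invP y := svalP (cid (inv_ex y)).
exists (fun t : arrows_from (tau Nx) => Tagged (fun y => arrow y x) (inv _ (tagged t))).
  case=> y a; exact: (congr1 (Tagged (fun y => arrow y x)) ((invP y).1 a)).
case=> y a; exact: (congr1 (Tagged (fun y => arrow (tau Nx) y)) ((invP y).2 a)).
Qed.

End MeshExactness.

(** A first choice of the v i only gives a tuple of the Phi (v i) that g kills.  For
projective y it vanishes; otherwise it factors through the map out of tau y, and
the mesh relation at y turns the factorization into a correction of the v i. *)
Lemma Phi_kernel_step (x y : PG) (r : nat) (alpha : 'I_r -> arrows_to y)
    (S : modA A) (inj : forall i, hom (vmod (tag (alpha i))) S)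
    (proj : forall i, hom S (vmod (tag (alpha i)))) (u : hom x y) :
  bijective alpha -> is_direct_sum inj proj ->
  right_minimal_almost_split (\sum_i
    Phi (karrow k (tagged (alpha i)) : hom (tag (alpha i) : PG) y) \oc proj i) ->
  Phi u = 0 ->
  exists v : forall i, hom x (tag (alpha i) : PG), (forall i, Phi (v i) = 0) /\
    imem J (u - \sum_i (karrow k (tagged (alpha i)) : hom (tag (alpha i) : PG) y) \oc v i).
Proof.
pose a i : hom (tag (alpha i) : PG) y := karrow k (tagged (alpha i)).
rewrite -!/(a _) => alpha_bij D ras u0.
pose g := \sum_i Phi (a i) \oc proj i.
have [e [v [uE He]]] := path_kcat_last_arrow u alpha_bij.
pose h := \sum_i inj i \oc Phi (v i).
have gh : Phi e + g \oc h = 0.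
  rewrite -u0 uE PhiD Phi_sum (sum_proj_sum_inj D); congr (_ + _).
  by apply: eq_bigr => i _; rewrite Phi_comp.
(* Otherwise g would be a split epimorphism, by gh. *)
have e0 : e = 0.
  case: He => // /Phi_iso[b [_ eb]]; case: (ras) => ns _ _; case: ns.
  exists (- h \oc b); rewrite -/g compA.
  have -> : g \oc - h = Phi e.
    by rewrite -sub0r compBr comp0r sub0r; apply/eqP; rewrite eq_sym -addr_eq0 gh.
  exact: eb.
move: gh uE; rewrite e0 Phi0 !add0r => gh uE.
have [yP|yN] := pselect (projective (vmod y)).
  have g_inj := right_almost_split_projective_inj yP ras.
  have h0 : h = 0.
    apply: homP => z; apply: g_inj; rewrite -/g.
    change (rhom_fun (g \oc h : rhom _ _) z = rhom_fun (g : rhom _ _) 0).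
    by rewrite gh rhom_map0.
  exists v; split => [i|]; last by rewrite uE subrr; apply: ideal0.
  by rewrite -(proj_sum_inj D (fun i => Phi (v i))) -/h h0 comp0r.
pose s i : hom (tau yN : PG) (tag (alpha i)) := karrow k (sigma yN (tagged (alpha i))).
pose f := \sum_i inj i \oc Phi (s i).
have las : left_minimal_almost_split f.
  apply: (@Phi_left_minimal_almost_split _ _ (fun i => sigma_arrow yN (alpha i)) S inj proj _ D).
  exact: bij_comp (sigma_arrow_bij yN) alpha_bij.
have mesh : imem J (\sum_i a i \oc s i) by apply: Span_rel; apply: MeshRelation.
have gf : g \oc f = 0.
  rewrite (sum_proj_sum_inj D); apply: etrans (Phi_J mesh); rewrite Phi_sum.
  by apply: eq_bigr => i _; rewrite Phi_comp.
have [w hw] := almost_split_weak_kernel (vmod_indecomposable y).1 yN las ras gf gh.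
have [t tw] := Phi_full w.
exists (fun i => v i - s i \oc t); split=> [i|].
  rewrite PhiB Phi_comp tw -(proj_sum_inj D (fun i => Phi (v i))) -/h hw compA.
  by rewrite (proj_sum_inj D) subrr.
rewrite uE -sumrB.
have -> : \sum_i (a i \oc v i - a i \oc (v i - s i \oc t)) = (\sum_i a i \oc s i) \oc t.
  rewrite comp_suml; apply: eq_bigr => i _.
  by rewrite compBr opprB addrC subrK compA.
exact: ideal_compr.
Qed.

Lemma Phi_kernel_trunc n (x y : PG) (u : hom x y) : Phi u = 0 ->
  exists u' : hom x y, imem J (u - u') /\ trunc n u' = 0.
Proof.
elim: n x y u => [|n IH] x y u u0.
  by exists u; rewrite subrr trunc_zero; split=> //; apply: ideal0.
have [r [alpha [S [inj [proj [alpha_bij D ras]]]]]] := Riedtmann_right FR y.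
have [v [v0 uv]] := Phi_kernel_step alpha_bij D ras u0.
pose w i := sval (cid (IH _ _ _ (v0 i))).
have wP i := svalP (cid (IH _ _ _ (v0 i))).
pose a i : hom (tag (alpha i) : PG) y := karrow k (tagged (alpha i)).
exists (\sum_i a i \oc w i); split; last first.
  rewrite trunc_sum big1 // => i _.
  apply: etrans (trunc_comp_pathl _ _ _) _.
  by rewrite [(_ - _)%N]subn1 [trunc _ _](wP i).2 comp0r.
have -> : u - \sum_i a i \oc w i =
    1 *: (u - \sum_i a i \oc v i) + \sum_i a i \oc (v i - w i).
  rewrite scale1r; under [X in _ = _ + X]eq_bigr do rewrite compBr.
  by rewrite sumrB addrA subrK.
apply: ideal_lin uv _; elim/big_rec: _ => [|i z _ Jz]; first exact: ideal0.
by rewrite -[_ \oc _]scale1r; apply: ideal_lin Jz; apply: ideal_compl; apply: (wP i).1.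
Qed.

(** The mesh relations are combinations of paths of length two. *)
Lemma mesh_ideal_trunc n (x y : PG) (u : hom x y) : imem J u -> imem J (trunc n u).
Proof.
apply: ideal_span_trunc n x y u => n _ _ _ [x Nx r alpha alpha_bij].
pose p i := PCons (tagged (alpha i)) (PCons (sigma Nx (tagged (alpha i))) (PNil _ _)).
have pE i : (karrow k (tagged (alpha i)) : hom (tag (alpha i) : PG) x) \oc
    (karrow k (sigma Nx (tagged (alpha i))) : hom (tau Nx : PG) (tag (alpha i))) =
    kpath k (p i) by apply: kcomp_path.
rewrite (eq_bigr _ (fun i _ => pE i)) trunc_sum.
have [n2|n2] := ltnP 2 n.
  rewrite (eq_bigr (fun i => kpath k (p i) : hom (tau Nx : PG) x)) => [|i _].
    by rewrite -(eq_bigr _ (fun i _ => pE i)); apply/Span_rel/MeshRelation.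
  by rewrite trunc_path n2.
by rewrite big1 => [|i _]; [apply: Span0 | rewrite trunc_path ltnNge n2].
Qed.

(** Truncation at a large n fixes u, kills the representative u' of u made of long
paths, and preserves the mesh ideal, which contains u - u'. *)
Lemma Phi_faithful (x y : PG) (u : hom x y) : Phi u = 0 -> imem J u.
Proof.
move=> u0; have [n nu] := trunc_large u.
have [u' [Juu' u'0]] := Phi_kernel_trunc n u0.
have := mesh_ideal_trunc n Juu'.
by rewrite -scaleN1r addrC trunc_lin u'0 scaler0 add0r nu.
Qed.

Lemma Fm_inj (x y : MG) : injective (@Fm x y).
Proof.
move=> f g e; rewrite -(qreprK f) -(qreprK g); apply/qpiP/Phi_faithful.
by rewrite PhiB /Phi !qreprK e subrr.
Qed.

Lemma Riedtmann_id_standard : standard G.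
Proof.
pose inv (x y : ind_category G) (f : hom x y) : hom (x : MG) (y : MG) :=
  qpi J (sval (cid (Phi_full f))).
have invK (x y : ind_category G) (f : hom x y) : Fm (inv x y f) = f := svalP (cid (Phi_full f)).
unshelve epose (F' := @KFunctor k (ind_category G) MG (fun x => x) inv _ _ _).
- by move=> x y a f g; apply: Fm_inj; rewrite Fm_lin !invK.
- by move=> x; apply: Fm_inj; rewrite invK Fm_id.
- by move=> x y z g f; apply: Fm_inj; rewrite Fm_comp !invK.
exists F, F'; split; apply: kfunctor_eq => x y f /=; last exact: invK.
by apply: Fm_inj; rewrite invK.
Qed.

End Comparison.

Theorem theorem6p2 (k : closedFieldType) (A : falgType k) (G : ar_component A) :
  generalized_standard G -> mesh_comparable G -> standard G.
Proof.
move=> G_gs [[o m m_lin m_id m_comp] FR].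
have E : o = (fun x => x) by apply/funext => x; apply: (Riedtmann_obj FR).
subst o; exact: Riedtmann_id_standard FR G_gs.
Qed.
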